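(* Let $(R,\mathfrak{m})$ be an artinian Gorenstein local ring of embedding dimension at least $3$ and socle degree $3$. If $R$ has an exact zero divisor, then $R$ is compressed and Koszul, and the quotient ring $R/\mathfrak{m}^3$ is not Golod.
   Context: A local ring is a commutative noetherian ring with a unique maximal ideal. The embedding dimension of $(R,\mathfrak{m})$ is the minimal number of generators of $\mathfrak{m}$. The socle degree of an artinian local ring $(R,\mathfrak{m})$ is the integer $s$ with $\mathfrak{m}^{s+1}=0\ne\mathfrak{m}^s$. Let $k=R/\mathfrak{m}$. Compressed: set $h_R(i)=\dim_k(\mathfrak{m}^i/\mathfrak{m}^{i+1})$. An artinian Gorenstein local ring $R$ of embedding dimension $e$ and socle degree $s$ is compressed if $h_R(i)=\min\left\{\binom{e-1+i}{e-1},\binom{e-1+s-i}{e-1}\right\}$ for all $0\le i\le s$ (the inequality $\le$ always holds). Koszul: $R$ is Koszul if its associated graded $k$-algebra $\bigoplus_{i\ge 0}\mathfrak{m}^i/\mathfrak{m}^{i+1}$ is Koszul in the traditional sense, i.e. $k$ has a linear minimal graded free resolution over it. Exact zero divisor: an element $a \ne 0$ of a commutative ring $R$ that is a zero divisor (so in a local ring $a$ is not a unit) and whose annihilator $(0:a)$ is a principal ideal. Golod ring: for a local ring $(S,\mathfrak{m}_S,k)$ with residue field $k$ the Poincar\'e series is $P^S_k(z)=\sum_{j\ge 0}\dim_k(\operatorname{Tor}^S_j(k,k))\,z^j$. Let $e$ be the embedding dimension and $d$ the depth of $S$, and let $K^S$ be the Koszul complex on a minimal set of generators of $\mathfrak{m}_S$.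 The ring $S$ is called Golod if $$P^S_k(z) = \frac{(1+z)^e}{1-\sum_{j=1}^{e-d}\dim_k(H_j(K^S))\,z^{j+1}}.$$ *)

(* Defs.v *)
From HB Require Import structures.
From mathcomp Require Import all_boot all_order all_algebra.
From mathcomp Require Import generic_quotient ring_quotient.
From mathcomp Require Import boolp classical_sets.

Set Implicit Arguments.
Unset Strict Implicit.
Unset Printing Implicit Defensive.
Import GRing.Theory.
Local Open Scope classical_set_scope.
Local Open Scope ring_scope.

Section Ideals.
Variable R : comNzRingType.

Definition is_ideal (I : set R) : Prop :=
  [/\ I 0, (forall x y, I x -> I y -> I (x + y))
    & forall a x, I x -> I (a * x)].

Definition gen (s : seq R) : set R :=
  [set y | exists c : nat -> R, y = \sum_(i < size s) c i * s`_i].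

Definition is_maximal (I : set R) : Prop :=
  [/\ is_ideal I, ~ I 1
    & forall J, is_ideal J -> ~ J 1 -> I `<=` J -> J = I].

Definition idprod (I J : set R) : set R :=
  [set x | exists n (a b : 'I_n -> R),
     (forall i, I (a i) /\ J (b i)) /\ x = \sum_(i < n) a i * b i].

Fixpoint idpow (I : set R) (n : nat) : set R :=
  if n is n'.+1 then idprod I (idpow I n') else setT.

Definition ann (a : R) : set R := [set x | a * x = 0].

Definition exact_zero_divisor (a : R) : Prop :=
  [/\ a != 0, (exists2 b, b != 0 & a * b = 0)
    & exists b, ann a = gen [:: b]].

(* Together with membership of s in the maximal ideal of a local ring R, this
   is R-regularity: R/(s) is then automatically nonzero. *)
Definition regular_seq (s : seq R) : Prop :=
  forall i y, (i < size s)%N ->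
    gen (take i s) (s`_i * y) -> gen (take i s) y.

Lemma is_ideal_opp I x : is_ideal I -> I x -> I (- x).
Proof. by case=> _ _ hM Ix; rewrite -mulN1r; apply: hM. Qed.

Lemma is_ideal_sum I n (F : 'I_n -> R) :
  is_ideal I -> (forall i, I (F i)) -> I (\sum_(i < n) F i).
Proof.
case=> I0 ID _ IF; apply: (big_ind (fun x => I x)) => // i _; exact: IF.
Qed.

Lemma is_ideal_gen s : is_ideal (gen s).
Proof.
split.
- by exists (fun=> 0); rewrite big1 // => i _; rewrite mul0r.
- move=> x y [c ->] [d ->]; exists (fun i => c i + d i).
  by rewrite -big_split /=; apply: eq_bigr => i _; rewrite mulrDl.
- move=> a x [c ->]; exists (fun i => a * c i).
  by rewrite big_distrr /=; apply: eq_bigr => i _; rewrite mulrA.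
Qed.

Lemma is_ideal_prod I J : is_ideal I -> is_ideal (idprod I J).
Proof.
move=> [I0 ID IM]; split.
- by exists 0, (fun=> 0), (fun=> 0); split=> [[]//|]; rewrite big_ord0.
- move=> x y [n [a [b [ab ->]]]] [m [c [d [cd ->]]]].
  pose u T (f : 'I_n -> T) (g : 'I_m -> T) (i : 'I_(n + m)) :=
    match split i with inl j => f j | inr j => g j end.
  exists (n + m)%N, (u _ a c), (u _ b d); split.
    by move=> i; rewrite /u; case: (split i).
  rewrite big_split_ord; congr (_ + _); apply: eq_bigr => i _.
    by rewrite /u (unsplitK (inl _ i)).
  by rewrite /u (unsplitK (inr _ i)).
- move=> r x [n [a [b [ab ->]]]]; exists n, (fun i => r * a i), b; split.
    by move=> i; have [? ?] := ab i; split=> //; apply: IM.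
  by rewrite big_distrr /=; apply: eq_bigr => i _; rewrite mulrA.
Qed.

Lemma is_ideal_pow I n : is_ideal I -> is_ideal (idpow I n).
Proof. by case: n => [|n] HI /=; [split | apply: is_ideal_prod]. Qed.

Lemma idprod_mono (I J K : set R) : J `<=` K -> idprod I J `<=` idprod I K.
Proof.
move=> JK x [n [a [b [ab ->]]]]; exists n, a, b; split=> // i.
by have [? ?] := ab i; split=> //; apply: JK.
Qed.

Lemma idprod_subl (I J : set R) : is_ideal I -> idprod I J `<=` I.
Proof.
move=> HI x [n [a [b [ab ->]]]]; apply: is_ideal_sum => // i.
by rewrite mulrC; case: HI => _ _; apply; case: (ab i).
Qed.

Lemma idpow_decr I n : is_ideal I -> idpow I n.+1 `<=` idpow I n.
Proof.
by move=> HI; elim: n => [|n IHn] //=; apply: idprod_mono.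
Qed.

Lemma idpow_mul I i j x y :
  is_ideal I -> idpow I i x -> idpow I j y -> idpow I (i + j) (x * y).
Proof.
move=> HI; elim: i x => [|i IHi] x.
  by move=> _ Iy; have [_ _] := is_ideal_pow j HI; apply.
move=> [n [a [b [ab ->]]]] Iy; rewrite addSn big_distrl /=.
exists n, a, (fun k => b k * y); split.
  by move=> k; have [? ?] := ab k; split=> //; apply: IHi.
by apply: eq_bigr => k _; rewrite mulrA.
Qed.

End Ideals.

Definition noetherian (R : comNzRingType) : Prop :=
  forall I : set R, is_ideal I -> exists s, I = gen s.

Definition artinian (R : comNzRingType) : Prop :=
  forall I : nat -> set R, (forall n, is_ideal (I n)) ->
    (forall n, I n.+1 `<=` I n) ->
    exists n, forall p, (n <= p)%N -> I p = I n.

(* Zorn: a proper ideal lies in a maximal one. *)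
Lemma ideal_sub_maximal (R : comNzRingType) (J : set R) :
  is_ideal J -> ~ J 1 -> exists2 M : set R, is_maximal M & J `<=` M.
Proof.
move=> HJ J1; pose P (A : set R) := is_ideal (A `|` J) /\ ~ (A `|` J) 1.
have [|A [[HA A1] Amax]] := @Zorn_bigcup _ (P : set (set R)).
  move=> F FP Ftot; have HF X : F X -> is_ideal (X `|` J) by move=> /FP[].
  have [J0 JD JM] := HJ; split; last first.
    by case=> [[X FX X1]|//]; have [_ []] := FP _ FX; left.
  split; first by right.
  - have aux X Y x y : F Y -> X `<=` Y -> (X `|` J) x -> (Y `|` J) y ->
        (\bigcup_(X in F) X `|` J) (x + y).
      move=> FY XY Xx Yy; have [_ YD _] := HF _ FY.
      have [|//|Yxy|Jxy] := YD x y; first by case: Xx => [/XY|]; [left|right].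
        by left; exists Y.
      by right.
    move=> x y [[X FX Xx]|Jx] [[Y FY Yy]|Jy].
    + have [XY|YX] := Ftot _ _ FX FY; first by apply: (aux X Y) => //; left.
      by rewrite addrC; apply: (aux Y X) => //; left.
    + by rewrite addrC; apply: (aux X X) => //; [right|left].
    + by apply: (aux Y Y) => //; [right|left].
    + by right; apply: JD.
  - move=> a x [[X FX Xx]|Jx]; last by right; apply: JM.
    have [_ _ XM] := HF _ FX.
    have [|Xax|Jax] := XM a x; first by left.
      by left; exists X.
    by right.
exists (A `|` J); last exact: subsetUr.
split=> // L HL L1 AJL; apply/seteqP; split=> // x Lx; left.
apply: contrapT => nAx; apply: (Amax L).
  split; first by move=> y Ay; apply: AJL; left.
  by move=> LA; apply: nAx; apply: LA.
have LJ : L `|` J = L by apply/setUidPl => y Jy; apply: AJL; right.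
by rewrite /P LJ.
Qed.

HB.mixin Record isLocalRing R & GRing.ComNzRing R := {
  maxid : set R;
  noetherianP : noetherian R;
  maxidP : is_maximal maxid;
  maxid_uniq : forall J : set R, is_maximal J -> J = maxid
}.

#[short(type="localRingType")]
HB.structure Definition LocalRing :=
  {R of GRing.ComNzRing R & isLocalRing R}.

Arguments maxid s : clear implicits.

Section LocalRingTheory.
Variable R : localRingType.
Local Notation m := (maxid R).

Lemma maxid_ideal : is_ideal m.
Proof. by case: (@maxidP R). Qed.

Lemma proper_sub_maxid (J : set R) : is_ideal J -> ~ J 1 -> J `<=` m.
Proof. by move=> HJ /(ideal_sub_maximal HJ)[M /maxid_uniq->]. Qed.

(* The boolean form of m^n, as needed by the library's ring quotients. *)
Definition mpow (n : nat) : {pred R} := fun x => `[< idpow m n x >].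

Lemma mpow_idealr n : idealr_closed (mpow n.+1).
Proof.
have [I0 ID IM] := is_ideal_pow n.+1 maxid_ideal.
split; first by apply/asboolP.
- apply/negP => /asboolP h; have [_ + _] := @maxidP R; apply.
  exact: idprod_subl maxid_ideal _ h.
- move=> a x y /asboolP hx /asboolP hy; apply/asboolP; apply: ID => //.
  exact: IM.
Qed.

HB.instance Definition _ n := isIdealr.Build R (mpow n.+1) (@mpow_idealr n).

End LocalRingTheory.

Arguments mpow R n : clear implicits.

(* A quotient of a local ring by a proper ideal is local, its maximal ideal
   being the image of the original one. *)
Section LocalQuotient.
Variables (R : localRingType) (I : idealr R).
Local Notation Q := {ideal_quot I}.
Local Notation p := (\pi_Q%qT : R -> Q).

Let p0 : p 0 = 0. Proof. exact: raddf0. Qed.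
Let pD : {morph p : x y / x + y}. Proof. exact: raddfD. Qed.
Let pM : {morph p : x y / x * y}. Proof. exact: rmorphM. Qed.
Let p1 : p 1 = 1. Proof. exact: rmorph1. Qed.

Let p_surj (y : Q) : exists x, y = p x.
Proof. by exists (repr y); rewrite reprK. Qed.

Let p_ker x y : p x = p y -> x - y \in I.
Proof. by move=> /eqP; rewrite -Quotient.idealrBE. Qed.

Let preim_ideal (J : set Q) : is_ideal J -> is_ideal (p @^-1` J).
Proof.
case=> J0 JD JM; split; rewrite /preimage /=.
- by rewrite p0.
- by move=> x y hx hy; rewrite pD; apply: JD.
- by move=> a x hx; rewrite pM; apply: JM.
Qed.

Let im_ideal (J : set R) : is_ideal J -> is_ideal (p @` J).
Proof.
case=> J0 JD JM; split.
- by exists 0.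
- move=> _ _ [x Jx <-] [y Jy <-]; exists (x + y); last exact: pD.
  exact: JD.
- move=> a _ [x Jx <-]; have [b ->] := p_surj a.
  exists (b * x); last exact: pM.
  exact: JM.
Qed.

Lemma quot_noetherian : noetherian Q.
Proof.
move=> J HJ; have [s Es] := @noetherianP R _ (preim_ideal HJ).
have HR c : p (\sum_(i < size s) c i * s`_i)
          = \sum_(i < size s) p (c i) * (map p s)`_i.
  rewrite raddf_sum; apply: eq_bigr => i _.
  by rewrite (nth_map 0) // -pM.
exists (map p s); apply/seteqP; split => y.
- have [x ->] := p_surj y => Jx.
  have : (p @^-1` J) x by [].
  rewrite Es => -[c ->]; exists (fun i => p (c i)).
  by rewrite HR size_map.
- case=> c ->; rewrite size_map.
  have -> : \sum_(i < size s) c i * (map p s)`_i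
    = p (\sum_(i < size s) repr (c i) * s`_i).
    by rewrite HR; apply: eq_bigr => i _; rewrite reprK.
  have : gen s (\sum_(i < size s) repr (c i) * s`_i).
    by exists (fun i => repr (c i)).
  by rewrite -Es.
Qed.

Let I_sub : [set x | x \in I] `<=` maxid R.
Proof.
apply: proper_sub_maxid => /=; last by rewrite idealr1.
split=> /=; first exact: idealr0.
- by move=> x y; apply: rpredD.
- by move=> a x; apply: idealMr.
Qed.

Lemma quot_maxidP : is_maximal (p @` maxid R).
Proof.
have [M0 MD MM] := maxid_ideal R; split; first exact/im_ideal/maxid_ideal.
- move=> [x Mx]; rewrite -p1 => /esym/p_ker/I_sub M1x.
  have [_ + _] := @maxidP R; apply.
  by rewrite -[1](subrK x); apply: MD.
- move=> J HJ J1 MJ; apply/seteqP; split=> // y.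
  have [x ->] := p_surj y => Jx; exists x => //.
  apply: (proper_sub_maxid (preim_ideal HJ)) => //.
  by rewrite /preimage /= p1.
Qed.

Lemma quot_maxid_uniq (J : set Q) : is_maximal J -> J = p @` maxid R.
Proof.
case=> HJ J1 Jmax; apply/esym/Jmax; first by case: quot_maxidP.
  by case: quot_maxidP.
move=> y; have [x ->] := p_surj y => Jx; exists x => //.
apply: (proper_sub_maxid (preim_ideal HJ)) => //.
by rewrite /preimage /= p1.
Qed.

HB.instance Definition _ :=
  isLocalRing.Build Q quot_noetherian quot_maxidP quot_maxid_uniq.

End LocalQuotient.

(* [has_kdim N N' d]: the vector space N/N' over k = R/m has dimension d. It is
   meant for submodules N' of N with m N contained in N', and says that N/N'
   has a k-basis of d elements, represented by vectors of N. *)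
Definition has_kdim (R : localRingType) (V : lmodType R) (N N' : set V)
    (d : nat) : Prop :=
  exists v : 'I_d -> V,
    [/\ forall i, N (v i),
        forall x, N x -> exists c : 'I_d -> R, N' (x - \sum_i c i *: v i)
      & forall c : 'I_d -> R,
          N' (\sum_i c i *: v i) -> forall i, maxid R (c i)].

Section Invariants.
Variable R : localRingType.
Local Notation m := (maxid R).

Lemma edim_subproof : exists n, `[< exists s, size s = n /\ m = gen s >].
Proof.
have [s Es] := @noetherianP R _ (maxid_ideal R).
by exists (size s); apply/asboolP; exists s.
Qed.

Definition edim : nat := ex_minn edim_subproof.

Definition socle_degree (s : nat) : Prop :=
  idpow m s.+1 = [set 0] /\ idpow m s <> [set 0].

Definition compressed : Prop :=
  exists2 s, socle_degree s &
    forall i, (i <= s)%N ->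
      has_kdim (idpow m i : set R^o) (idpow m i.+1)
        (minn 'C(edim - 1 + i, edim - 1) 'C(edim - 1 + (s - i), edim - 1)).

Definition is_depth (d : nat) : Prop :=
  (exists s : seq R,
     [/\ size s = d, {in s, forall x, m x} & regular_seq s]) /\
  (forall s : seq R,
     {in s, forall x, m x} -> regular_seq s -> (size s <= d)%N).

End Invariants.

Definition injective_module (R : comNzRingType) (E : lmodType R) : Prop :=
  forall (A B : lmodType R) (i : {linear A -> B}) (f : {linear A -> E}),
    injective i -> exists g : {linear B -> E}, forall x, g (i x) = f x.

(* M has an injective resolution 0 -> M -> E 0 -> ... -> E n -> 0. *)
Definition injdim_le (R : comNzRingType) (M : lmodType R) (n : nat) : Prop :=
  exists (E : nat -> lmodType R) (eta : {linear M -> E 0%N})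
         (d : forall j, {linear E j -> E j.+1}),
    [/\ forall j, injective_module (E j),
        forall j, (n < j)%N -> forall x : E j, x = 0,
        injective eta,
        forall x, d 0%N x = 0 <-> exists y, x = eta y
      & forall j x, d j.+1 x = 0 <-> exists y, x = d j y].

Definition gorenstein (R : localRingType) : Prop :=
  exists n, injdim_le (R^o : lmodType R) n.

(* A resolution ... -> A^(b 1) -> A^(b 0) -> A/I -> 0 of the cyclic module A/I
   by free modules of finite rank. Elements of A^n are row vectors, on which
   matrices act on the right; the augmentation A^(b 0) -> A/I is the class
   modulo I of v *m c. *)
Definition free_resolution (A : comNzRingType) (I : set A) (b : nat -> nat)
    (D : forall i, 'M[A]_(b i.+1, b i)) (c : 'cV[A]_(b 0%N)) : Prop :=
  [/\ exists v : 'rV[A]_(b 0%N), I ((v *m c) 0 0 - 1),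
      forall v : 'rV[A]_(b 0%N), I ((v *m c) 0 0) <-> exists w, v = w *m D 0%N
    & forall i (v : 'rV[A]_(b i.+1)),
        v *m D i = 0 <-> exists w, v = w *m D i.+1].

Section Koszul.
Variables (A : comNzRingType) (grade : nat -> set A).

Definition irrelevant_ideal : set A :=
  [set x | exists n (y : nat -> A),
     (forall i, grade i.+1 (y i)) /\ x = \sum_(i < n) y i].

(* Linear free resolution of k = A/A_+: with the generators of the i-th free
   module in degree i, the differentials are matrices of linear forms. Such a
   resolution is automatically graded and minimal. *)
Definition koszul_algebra : Prop :=
  exists (b : nat -> nat) (D : forall i, 'M[A]_(b i.+1, b i))
         (c : 'cV[A]_(b 0%N)),
    [/\ free_resolution irrelevant_ideal D c,
        forall i, grade 0%N (c i 0)
      & forall i j l, grade 1%N (D i j l)].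

End Koszul.

(* The associated graded ring is built as the quotient of the Rees algebra,
   the subring of R[t] of polynomials whose coefficient of t^i is in m^i, by
   the ideal of those whose coefficient of t^i is in m^(i+1). *)
Section AssociatedGraded.
Variable R : localRingType.
Local Notation m := (maxid R).

Definition rees_pred : {pred {poly R}} :=
  fun p => `[< forall i, idpow m i p`_i >].

Lemma rees_subring : subring_closed rees_pred.
Proof.
split.
- apply/asboolP => i; rewrite coef1; case: i => [|i] //=.
  by have [+ _ _] := is_ideal_pow i.+1 (maxid_ideal R).
- move=> x y /asboolP hx /asboolP hy; apply/asboolP => i; rewrite coefB.
  have HI := is_ideal_pow i (maxid_ideal R); have [_ ID _] := HI.
  by apply: ID => //; apply: is_ideal_opp.
- move=> x y /asboolP hx /asboolP hy; apply/asboolP => i; rewrite coefM.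
  apply: is_ideal_sum; first exact/is_ideal_pow/maxid_ideal.
  move=> j; rewrite -{1}(subnKC (ltn_ord j : (j <= i)%N)).
  exact/idpow_mul/hy/hx/maxid_ideal.
Qed.

HB.instance Definition _ :=
  GRing.isSubringClosed.Build {poly R} rees_pred rees_subring.

Record rees := Rees { rees_val :> {poly R}; _ : rees_val \in rees_pred }.

HB.instance Definition _ := [isSub for rees_val].
HB.instance Definition _ := [Choice of rees by <:].
HB.instance Definition _ := [SubChoice_isSubComNzRing of rees by <:].

Lemma reesP (p : rees) i : idpow m i (val p)`_i.
Proof. by case: p => p /= /asboolP. Qed.

Definition rees_ideal : {pred rees} :=
  fun p => `[< forall i, idpow m i.+1 (val p)`_i >].

Lemma rees_ideal_closed : idealr_closed rees_ideal.
Proof.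
have HI i := is_ideal_pow i (maxid_ideal R).
split.
- apply/asboolP => i; rewrite rmorph0 coef0; by have [+ _ _] := HI i.+1.
- apply/negP => /asboolP /(_ 0%N); rewrite rmorph1 coef1 /= => h.
  have [_ + _] := @maxidP R; apply.
  exact: idprod_subl (maxid_ideal R) _ h.
- move=> a u v /asboolP hu /asboolP hv; apply/asboolP => i.
  rewrite rmorphD rmorphM coefD; have [_ ID _] := HI i.+1; apply: ID => //.
  rewrite coefM; apply: is_ideal_sum => // j.
  rewrite -{1}(subnKC (ltn_ord j : (j <= i)%N)) -addnS.
  apply: idpow_mul; [exact: maxid_ideal | exact: reesP | exact: hu].
Qed.

HB.instance Definition _ := isIdealr.Build rees rees_ideal rees_ideal_closed.

Definition assoc_graded : comNzRingType := {ideal_quot rees_ideal}.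

Definition assoc_grade (n : nat) : set assoc_graded :=
  [set x | exists2 p : rees, (forall i, i != n -> (val p)`_i = 0)
                           & x = \pi_({ideal_quot rees_ideal})%qT p].

Definition koszul : Prop := koszul_algebra assoc_grade.

End AssociatedGraded.

(* For a free resolution (b, D) of k, Tor_j(k, k) is the homology at j of
   F tensor k; its cycles and boundaries in k^(b j) are given here by their
   preimages in R^(b j). *)
Section Tor.
Variables (R : localRingType) (b : nat -> nat).
Variable D : forall i, 'M[R]_(b i.+1, b i).
Local Notation m := (maxid R).

Definition tor_cycles (j : nat) : set 'rV[R]_(b j) :=
  match j with
  | 0%N => setT
  | j'.+1 => [set v | forall l, m ((v *m D j') 0 l)]
  end.

Definition tor_boundaries (j : nat) : set 'rV[R]_(b j) :=
  [set v | exists w : 'rV[R]_(b j.+1), forall l, m ((v - w *m D j) 0 l)].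

End Tor.

Arguments tor_cycles {R b} D j.
Arguments tor_boundaries {R b} D j.

(* P j is the j-th coefficient of the Poincare series of k over R. *)
Definition poincare (R : localRingType) (P : nat -> nat) : Prop :=
  exists (b : nat -> nat) (D : forall i, 'M[R]_(b i.+1, b i))
         (c : 'cV[R]_(b 0%N)),
    free_resolution (maxid R) D c /\
    forall j, has_kdim (tor_cycles D j) (tor_boundaries D j) (P j).

(* The Koszul complex on s: its degree j part is free on the j-subsets J of
   {0, ..., size s - 1}, J standing for the exterior product of the basis
   vectors e_i, i in J, in increasing order, and
   d(e_J) = \sum_(i in J) (-1)^#{l in J | l < i} s_i e_(J \ i). *)
Section KoszulComplex.
Variables (R : comNzRingType) (s : seq R).
Local Notation n := (size s).
Local Notation K := {ffun {set 'I_n} -> R^o}.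

Definition koszul_diff (f : K) : K :=
  [ffun J : {set 'I_n} => \sum_(i | i \notin J)
     (-1) ^+ #|[set l in J | (l < i)%N]| * s`_i * f (i |: J)].

Definition koszul_part (j : nat) : set K :=
  [set f | forall J : {set 'I_n}, #|J| != j -> f J = 0].

Definition koszul_cycles (j : nat) : set K :=
  [set f | koszul_part j f /\ koszul_diff f = 0].

Definition koszul_boundaries (j : nat) : set K :=
  koszul_diff @` koszul_part j.+1.

End KoszulComplex.

Arguments koszul_cycles {R} s j.
Arguments koszul_boundaries {R} s j.

(* The identity of power series defining Golod rings, multiplied by its
   denominator and read coefficientwise. *)
Definition golod (R : localRingType) : Prop :=
  exists (d : nat) (s : seq R) (h P : nat -> nat),
    [/\ is_depth R d,
        size s = edim R /\ maxid R = gen s,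
        forall j, has_kdim (koszul_cycles s j) (koszul_boundaries s j) (h j),
        poincare R P
      & let q : {poly int} :=
          1 - \sum_(1 <= j < (edim R - d).+1) (h j)%:Z *: 'X^(j.+1) in
        forall n, \sum_(i < n.+1) (P i)%:Z * q`_(n - i)
                  = ((1 + 'X) ^+ edim R : {poly int})`_n].

(* Main.v *)
(* Self-injectivity (finite injective dimension over an artinian local ring) gives
   a one-dimensional socle k s = m^3 and b with 0:a = (b), 0:b = (a). Since the
   embedding dimension is at least 3, neither a nor b lies in m^2, and then
   0:m^2 = m^2; so m/m^2 and m^2/m^3 are dual and R is compressed.

   The pair (a, b) forces all syzygies N in R^p of k to satisfy m N = l N + a N for
   every l in m outside (a) + m^2, and to inherit exactness of (a, b) on m N. This
   property passes from N to its first syzygy, and it implies that the minimal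
   resolution of k over R stays exact after taking initial forms, so R is Koszul
   and P_R(z) (1 - e z + e z^2 - z^3) = 1.

   Over R/m^3 the kernel of each reduced differential splits as the next image plus
   copies of k, hence 1/P_{R/m^3} = 1/P_R - z^2 is a cubic. If R/m^3 were Golod,
   its denominator would be this cubic times (1 + z)^e', of degree e' + 3, whereas
   a Golod denominator has degree at most e' + 1. *)

Require Import Defs.
From HB Require Import structures.
From mathcomp Require Import all_boot all_order all_algebra.
From mathcomp Require Import generic_quotient ring_quotient.
From mathcomp Require Import boolp classical_sets.
From mathcomp Require Import zify ring.
Set Implicit Arguments.
Unset Strict Implicit.
Unset Printing Implicit Defensive.
Import GRing.Theory.
Local Open Scope classical_set_scope.
Local Open Scope ring_scope.

(** * Powers of the maximal ideal *)

(** Finite injective dimension is brought down to Baer's criterion for R itself by walking back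
    along the injective resolution, each kernel inheriting the criterion from the next one; a
    nonzero element killed by m makes this descent work. The bound on the embedding dimension enters
    through one contradiction, that m would be spanned modulo m^2 by two elements. Its decisive use:
    for l in m off the line of a, the functional z |-> b l z on m/m^2 has a kernel of dimension at
    least 2, so some l' off the line has l l' in a m. This relation is what carries m N = l N + a N
    over to syzygies. Exactness must be carried for a and b together, since each step exchanges
    them: a syzygy killed by a is b u, and u S is then killed by b. A Golod ring comes with an
    arbitrary resolution, so Tor has to be compared between resolutions before Betti numbers can be
    counted. *)

Lemma nth_gen (R : comNzRingType) (s : seq R) i : (i < size s)%N -> gen s s`_i.
Proof.
move=> lt_i; exists (fun j => (j == i)%:R).
rewrite (bigD1 (Ordinal lt_i)) //= eqxx mul1r big1 ?addr0 // => j.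
by rewrite -val_eqE /= => /negPf->; rewrite mul0r.
Qed.

Section LocalBasics.
Variable R : localRingType.
Local Notation m := (maxid R).
Local Notation M := (idpow (maxid R)).
Implicit Types x y z : R.

Lemma mpow0 n : M n 0.
Proof. by case: (is_ideal_pow n (maxid_ideal R)). Qed.

Lemma mpowD n x y : M n x -> M n y -> M n (x + y).
Proof. by case: (is_ideal_pow n (maxid_ideal R)) => _ + _; apply. Qed.

Lemma mpowMl n x y : M n y -> M n (x * y).
Proof. by case: (is_ideal_pow n (maxid_ideal R)) => _ _; apply. Qed.

Lemma mpowMr n x y : M n x -> M n (x * y).
Proof. by rewrite mulrC; apply: mpowMl. Qed.

Lemma mpowN n x : M n x -> M n (- x).
Proof. by apply: is_ideal_opp; apply/is_ideal_pow/maxid_ideal. Qed.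

Lemma mpowB n x y : M n x -> M n y -> M n (x - y).
Proof. by move=> hx hy; apply/mpowD/mpowN. Qed.

Lemma mpowM i j x y : M i x -> M j y -> M (i + j) (x * y).
Proof. by move=> hx hy; apply: idpow_mul => //; apply: maxid_ideal. Qed.

Lemma mpow_sum (I : Type) (r : seq I) (P : pred I) n (F : I -> R) :
  (forall i, P i -> M n (F i)) -> M n (\sum_(i <- r | P i) F i).
Proof. by move=> h; apply: big_ind => //; [exact: mpow0|exact: mpowD]. Qed.

Lemma mpow_le i j x : (i <= j)%N -> M j x -> M i x.
Proof.
move=> /subnK <-; elim: (j - i)%N => // k IH.
by rewrite addSn => /(idpow_decr (maxid_ideal R)) /IH.
Qed.

Lemma mpow1 : M 1 = m.
Proof.
apply/seteqP; split=> x; first exact: (idprod_subl (maxid_ideal R)).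
by move=> mx; exists 1%N, (fun=> x), (fun=> 1); rewrite big_ord1 mulr1.
Qed.

Lemma mpow1E x : m x -> M 1 x. Proof. by rewrite mpow1. Qed.

Lemma maxidN1 : ~ m 1.
Proof. by case: (@maxidP R). Qed.

Lemma mpow_dichotomy x : M 1 x \/ exists y, x * y = 1.
Proof.
case: (pselect (exists y, x * y = 1)) => [|h]; first by right.
left; apply: mpow1E; apply: (@proper_sub_maxid R (gen [:: x])).
- exact: is_ideal_gen.
- case=> c; rewrite big_ord1 /= => e; apply: h; exists (c 0%N).
  by rewrite mulrC -e.
- by exists (fun=> 1); rewrite big_ord1 mul1r.
Qed.

Lemma mpow1_noninv x : ~ M 1 x -> exists y, x * y = 1.
Proof. by case: (mpow_dichotomy x). Qed.

Definition inM n p q (A : 'M[R]_(p, q)) := forall i j, M n (A i j).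

Lemma inM0 n p q : inM n (0 : 'M[R]_(p, q)).
Proof. by move=> i j; rewrite mxE; apply: mpow0. Qed.

Lemma inMD n p q (A B : 'M[R]_(p, q)) : inM n A -> inM n B -> inM n (A + B).
Proof. by move=> hA hB i j; rewrite mxE; apply: mpowD. Qed.

Lemma inMN n p q (A : 'M[R]_(p, q)) : inM n A -> inM n (- A).
Proof. by move=> hA i j; rewrite mxE; apply: mpowN. Qed.

Lemma inMB n p q (A B : 'M[R]_(p, q)) : inM n A -> inM n B -> inM n (A - B).
Proof. by move=> hA hB; apply/inMD/inMN. Qed.

Lemma inMM i j p q r (A : 'M[R]_(p, q)) (B : 'M[R]_(q, r)) :
  inM i A -> inM j B -> inM (i + j) (A *m B).
Proof.
by move=> hA hB k l; rewrite mxE; apply: mpow_sum => t _; apply: mpowM.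
Qed.

Lemma inMMl n p q r (A : 'M[R]_(p, q)) (B : 'M[R]_(q, r)) :
  inM n B -> inM n (A *m B).
Proof. by apply: (@inMM 0). Qed.

Lemma inMMr n p q r (A : 'M[R]_(p, q)) (B : 'M[R]_(q, r)) :
  inM n A -> inM n (A *m B).
Proof. by rewrite -{2}[n]addn0 => h; apply: inMM. Qed.

Lemma inMZ i j p q a (A : 'M[R]_(p, q)) :
  M i a -> inM j A -> inM (i + j) (a *: A).
Proof. by move=> ha hA k l; rewrite mxE; apply: mpowM. Qed.

Lemma inMZr n p q a (A : 'M[R]_(p, q)) : inM n A -> inM n (a *: A).
Proof. exact: (@inMZ 0). Qed.

Lemma inMZl n p q a (A : 'M[R]_(p, q)) : M n a -> inM n (a *: A).
Proof. by move=> h; rewrite -[n]addn0; apply: inMZ. Qed.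

Lemma choice_exists (T U : Type) (P : T -> U -> Prop) :
  (forall t, exists u, P t u) -> exists f, forall t, P t (f t).
Proof. by move=> /choice[f hf]; exists f. Qed.

Lemma mx_choice p q (P : 'I_p -> 'I_q -> R -> Prop) :
  (forall i j, exists x, P i j x) ->
  exists A : 'M[R]_(p, q), forall i j, P i j (A i j).
Proof.
move=> h; have [f hf] := choice_exists (fun i => choice_exists (h i)); exists (\matrix_(i, j) f i j) => i j.
by rewrite mxE.
Qed.

Lemma row_choice p q (P : 'I_p -> 'rV[R]_q -> Prop) :
  (forall i, exists v, P i v) ->
  exists A : 'M[R]_(p, q), forall i, P i (row i A).
Proof.
move=> /choice[f hf]; exists (\matrix_i f i) => i; by rewrite rowK.
Qed.

End LocalBasics.
Arguments inM {R} n {p q} A.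
Arguments idpow {R} I n : simpl never.

(** * Self-injectivity *)

(** Bundling an ideal with its proof lets the module structure on it be inferred, so that the
    inclusion of I in R can be fed to an injective module. *)
Record ideal_of (R : comNzRingType) :=
  IdealOf { ideal_set : set R; ideal_setP : is_ideal ideal_set }.

Section IdealModule.
Variables (R : comNzRingType) (I : ideal_of R).

Definition ideal_pred : {pred R^o} := fun x => `[< ideal_set I x >].

Lemma ideal_pred_submod : GRing.submod_closed ideal_pred.
Proof.
have [I0 ID IM] := ideal_setP I.
split; first by apply/asboolP.
by move=> a x y /asboolP hx /asboolP hy; apply/asboolP; apply: ID => //; apply: IM.
Qed.

HB.instance Definition _ :=
  GRing.isSubmodClosed.Build R R^o ideal_pred ideal_pred_submod.

Record ideal_module :=
  IdealModule { ideal_val : R^o; _ : ideal_val \in ideal_pred }.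

HB.instance Definition _ := [isSub for ideal_val].
HB.instance Definition _ := [Choice of ideal_module by <:].
HB.instance Definition _ := [SubChoice_isSubLmodule of ideal_module by <:].

End IdealModule.

Section SelfInjective.
Variable R : localRingType.

(* Baer's criterion for the submodule Z of E; taking Z to be a set spares the
   construction of kernels of module maps as modules. *)
Definition baer (E : lmodType R) (Z : set E) : Prop :=
  forall (I : set R) (f : R -> E), is_ideal I ->
    (forall x, I x -> Z (f x)) ->
    (forall x y, I x -> I y -> f (x + y) = f x + f y) ->
    (forall c x, I x -> f (c * x) = c *: f x) ->
  exists e, Z e /\ forall x, I x -> f x = x *: e.

Lemma injective_baer (E : lmodType R) : injective_module E -> baer (setT : set E).
Proof.
move=> injE I f HI _ fD fM.
pose J := IdealOf HI; pose A : lmodType R := ideal_module J.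
have AI (x : ideal_module J) : I (\val x) by case: x => x /= /asboolP.
pose g (x : A) : E := f (\val (x : ideal_module J)).
have gl : linear g.
  move=> c x y; have [_ _ IM] := HI.
  have -> : g (c *: x + y) = f (c * \val (x : ideal_module J) + \val (y : ideal_module J)).
    by congr f; exact: (linearP (\val : ideal_module J -> R^o)).
  by rewrite fD ?fM //; apply: IM.
pose ga := GRing.isLinear.Build R A E *:%R g gl.
pose gL : {linear A -> E} := HB.pack g ga.
have vi : injective (\val : A -> R^o) by exact: val_inj.
have [h hg] := injE A (R^o : lmodType R) (\val : {linear A -> R^o}) gL vi.
exists (h 1); split=> // x Ix.
have xJ : x \in ideal_pred J by apply/asboolP.
have := hg (IdealModule xJ); rewrite /gL /= /g /= => <-.
by rewrite -[in RHS]linearZ /= -[in LHS](mulr1 x).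
Qed.

End SelfInjective.

(** A failure at I would give, by dependent choice, a strictly increasing chain of ideals; its union
    is finitely generated, so one term of the chain contains it. *)
Lemma noetherian_ind (R : comNzRingType) (P : set R -> Prop) :
  noetherian R ->
  (forall I, is_ideal I ->
     (forall J, is_ideal J -> I `<=` J -> ~ J `<=` I -> P J) -> P I) ->
  forall I, is_ideal I -> P I.
Proof.
move=> noeth IH I HI; apply: contrapT => nPI.
pose T := {J : set R | is_ideal J /\ ~ P J}.
have next (J : T) : exists K : T, sval J `<=` sval K /\ ~ sval K `<=` sval J.
  case: J => J /= [HJ nPJ]; apply: contrapT => h; apply: nPJ; apply: IH => // K HK JK KJ.
  by apply: contrapT => nPK; apply: h; exists (exist _ K (conj HK nPK)).
have [g hg] := choice_exists next.
pose F n := iter n g (exist _ I (conj HI nPI)).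
have Fle i j : (i <= j)%N -> sval (F i) `<=` sval (F j).
  move=> /subnK <-; elim: (j - i)%N => // k IHk x /IHk.
  by rewrite addSn; apply: (hg _).1.
have Fid n : is_ideal (sval (F n)) by case: (F n) => ? [].
pose U := [set x | exists n, sval (F n) x].
have HU : is_ideal U.
  split.
  - by exists 0%N; case: (Fid 0%N).
  - move=> x y [i hx] [j hy]; exists (maxn i j).
    case: (Fid (maxn i j)) => _ + _; apply.
      exact: (Fle _ _ (leq_maxl i j)).
    exact: (Fle _ _ (leq_maxr i j)).
  - by move=> a x [n hx]; exists n; case: (Fid n) => _ _; apply.
have [s Us] := noeth _ HU.
have inU i : (i < size s)%N -> exists n, sval (F n) s`_i.
  move=> lt_i; suff: U s`_i by [].
  by rewrite Us; apply: nth_gen.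
have [h hh] : exists h : nat -> nat, forall i, (i < size s)%N -> sval (F (h i)) s`_i.
  apply: (@choice_exists _ _ (fun i n => (i < size s)%N -> sval (F n) s`_i)) => i.
  case: (ltnP i (size s)) => [/inU[n ?]|]; first by exists n.
  by exists 0%N.
pose N := \max_(i < size s) h i.
case: (hg (F N)) => _; apply=> x hx.
have : U x by exists N.+1.
rewrite Us => -[c ->]; apply: is_ideal_sum => // i.
case: (Fid N) => _ _; apply; apply: (Fle (h i)); last exact: hh.
exact: leq_bigmax.
Qed.

(** * From finite injective dimension to self-injectivity *)

Section Injdim.
Variable R : localRingType.
Local Notation M := (idpow (maxid R)).

(** The last hypothesis makes the map i + c s |-> c y well defined on I + (s), and Baer's criterion
    extends it. In the proof [g] picks a coefficient c for each element of I + (s). *)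
Lemma baer_ext (E : lmodType R) (Z : set E) (I : set R) s y :
  baer Z -> (forall c, Z (c *: y)) -> is_ideal I ->
  (forall c, I (c * s) -> c *: y = 0) ->
  exists e, [/\ Z e, forall x, I x -> x *: e = 0 & s *: e = y].
Proof.
move=> bZ Zy HI hy; have [I0 ID IM] := HI.
pose J := [set z | exists c, I (z - c * s)].
have cP z : exists c, J z -> I (z - c * s).
  by case: (pselect (J z)) => [[c ?]|?]; [exists c | exists 0].
have [g hg] := choice_exists cP.
have gE z c : I (z - c * s) -> g z *: y = c *: y.
  move=> hc; apply/eqP; rewrite -subr_eq0 -scalerBl; apply/eqP/hy.
  have -> : (g z - c) * s = (z - c * s) - (z - g z * s) by ring.
  by apply: ID => //; apply: is_ideal_opp => //; apply: hg; exists c.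
have HJ : is_ideal J.
  split.
  - by exists 0; rewrite mul0r subr0.
  - move=> u v [c hc] [d hd]; exists (c + d).
    have -> : u + v - (c + d) * s = (u - c * s) + (v - d * s) by ring.
    exact: ID.
  - move=> r u [c hc]; exists (r * c).
    have -> : r * u - r * c * s = r * (u - c * s) by ring.
    exact: IM.
have [|||e [Ze he]] := bZ J (fun z => g z *: y) HJ.
- by move=> x _; apply: Zy.
- move=> u v /hg hu /hg hv; rewrite -scalerDl; apply: gE.
  have -> : u + v - (g u + g v) * s = (u - g u * s) + (v - g v * s) by ring.
  exact: ID.
- move=> c u /hg hu; rewrite scalerA; apply: gE.
  have -> : c * u - c * g u * s = c * (u - g u * s) by ring.
  exact: IM.
exists e; split=> //.
  move=> x Ix; have Ix0 : I (x - 0 * s) by rewrite mul0r subr0.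
  by rewrite -he ?(gE _ _ Ix0) ?scale0r //; exists 0.
have Is : I (s - 1 * s) by rewrite mul1r subrr.
by rewrite -he ?(gE _ _ Is) ?scale1r //; exists 1.
Qed.

Variables (N : nat) (sg : R).
Hypotheses (MN0 : M N = [set 0]) (sg_neq0 : sg != 0)
  (msg : forall x, M 1 x -> x * sg = 0).

(** If e extends f into E, then d e is killed by I, and e must be corrected by a preimage of d e
    that is killed by I as well. That such preimages exist is the vanishing of Ext^1(R/I, ker d); it
    is proved by noetherian induction on I. *)
Lemma baer_ker (E E' : lmodType R) (d : {linear E -> E'}) :
  baer (setT : set E) -> baer (range d) -> baer [set x | d x = 0].
Proof.
move=> bE bE'.
(* Case I = m: inside the range of d, y is divisible by the socle element, y = sg (d x), and sg x is
   killed by m. *)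
have base y : range d y -> (forall r, M 1 r -> r *: y = 0) ->
    exists x, (forall r, M 1 r -> r *: x = 0) /\ d x = y.
  move=> [x0 _ dx0] my.
  have [|||e [[x _ dx] _ he]] := @baer_ext _ _ [set 0] sg y bE'.
  - by move=> c; exists (c *: x0) => //; rewrite linearZ /= dx0.
  - split=> [//|x z ->->|c x ->]; first by rewrite addr0.
    by rewrite mulr0.
  - move=> c /= cs; apply: my; case: (mpow_dichotomy c) => // -[c' e].
    by move: sg_neq0; rewrite -[sg]mul1r -e mulrAC cs mul0r eqxx.
  exists (sg *: x); split; last by rewrite linearZ /= dx.
  by move=> r mr; rewrite scalerA msg // scale0r.
have main I : is_ideal I -> forall y, range d y -> (forall r, I r -> r *: y = 0) ->
    exists x, (forall r, I r -> r *: x = 0) /\ d x = y.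
  move: I; apply: (noetherian_ind (@noetherianP R)) => I HI IH y yr Iy.
  have [I0 ID IM] := HI.
  case: (pselect (I 1)) => I1.
    exists 0; split; first by move=> r _; rewrite scaler0.
    by rewrite linear0 -[y]scale1r Iy.
  (* The class of s spans a copy of k in R/I; s is taken in the last power of m that I does not
     contain. *)
  have [s nIs ms] : exists2 s, ~ I s & forall r, M 1 r -> I (r * s).
    have : M N `<=` I by rewrite MN0 => x ->.
    elim: N => [|n IHn] MnI; first by case: I1; apply: MnI.
    case: (pselect (M n `<=` I)) => [/IHn//|/existsNP[s /not_implyP[Ms nIs]]].
    by exists s => // r mr; apply: MnI; apply: (mpowM mr).
  have HJ : is_ideal [set z | exists c, I (z - c * s)].
    split.
    - by exists 0; rewrite mul0r subr0.
    - move=> u v [c hc] [c' hd]; exists (c + c').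
      have -> : u + v - (c + c') * s = (u - c * s) + (v - c' * s) by ring.
      exact: ID.
    - move=> r u [c hc]; exists (r * c).
      have -> : r * u - r * c * s = r * (u - c * s) by ring.
      exact: IM.
  have [||x1 [mx1 dx1]] := base (s *: y).
  - by case: yr => x0 _ <-; exists (s *: x0) => //; rewrite linearZ.
  - by move=> r mr; rewrite scalerA Iy //; apply: ms.
  (* Subtracting d x' makes y killed by s too, so the induction hypothesis applies to the larger
     ideal I + (s). *)
  have [//||x' [_ Ix' sx']] := @baer_ext _ _ I s x1 bE _ HI.
  - move=> c Ics; apply: mx1; case: (mpow_dichotomy c) => // -[c' e].
    by case: nIs; rewrite -[s]mul1r -e mulrAC mulrC; apply: IM.
  have [||||x'' [Jx'' dx'']] := IH _ HJ _ _ (y - d x').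
  - by move=> x Ix; exists 0; rewrite mul0r subr0.
  - by move=> h; apply: nIs; apply: h; exists 1; rewrite mul1r subrr.
  - by case: yr => x0 _ <-; exists (x0 - x') => //; rewrite linearB.
  - move=> r [c hc]; have -> : r = (r - c * s) + c * s by rewrite subrK.
    rewrite scalerDl scalerBr Iy // sub0r -linearZ Ix' // linear0 oppr0 add0r.
    by rewrite -scalerA scalerBr -dx1 -sx' linearZ subrr scaler0.
  exists (x' + x''); split; last by rewrite linearD dx'' /= addrC subrK.
  move=> r Ir; rewrite scalerDr Ix' // Jx'' ?addr0 //.
  by exists 0; rewrite mul0r subr0.
move=> I f HI fk fD fM.
have [//|e [_ he]] := bE I f HI _ fD fM.
have [||x2 [Ix2 dx2]] := main I HI (d e).
- by exists e.
- by move=> r Ir; rewrite -linearZ -he //; apply: fk.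
exists (e - x2); split; first by rewrite /= linearB dx2 subrr.
by move=> x Ix; rewrite scalerBr Ix2 // subr0 he.
Qed.

(** Downward induction along the resolution: the kernels are trivial beyond n, the range of d j is
    the kernel of d j.+1, and R is the kernel of d 0. *)
Lemma gorenstein_baer : gorenstein R -> baer (setT : set (R^o : lmodType R)).
Proof.
move=> [n [E [eta [d [injE E0 eta_inj d0 dS]]]]].
have bE j : baer (setT : set (E j)) by apply/injective_baer/injE.
have bk j : baer [set x | d j x = 0].
  elim: {j}(n.+1 - j)%N {-2}j (erefl (n.+1 - j)%N) => [|k IHk] j ej.
    move=> I f HI _ fD fM; have [//|e [_ he]] := bE j I f HI _ fD fM.
    exists e; split=> //=; apply: E0; lia.
  apply: baer_ker => //.
  have -> : range (d j) = [set x | d j.+1 x = 0].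
    apply/seteqP; split=> x /=; first by move=> [y _ <-]; apply/dS; exists y.
    by move=> /dS[y ->]; exists y.
  by apply: IHk; lia.
move=> I f HI _ fD fM.
have [|||e [/d0[x ->] he]] := bk 0%N I (fun x => eta (f x)) HI.
- by move=> x _; apply/d0; exists (f x).
- by move=> x y Ix Iy; rewrite fD // linearD.
- by move=> c x Ix; rewrite fM // linearZ.
exists x; split=> // y Iy; apply: eta_inj; rewrite linearZ; exact: he.
Qed.

End Injdim.

(** * Dimensions over the residue field *)

Section Kdim.
Variable R : localRingType.
Local Notation m := (maxid R).
Local Notation M := (idpow (maxid R)).

Definition submod (V : lmodType R) (N : set V) : Prop :=
  [/\ N 0, forall x y, N x -> N y -> N (x + y) & forall a x, N x -> N (a *: x)].

Lemma submodB (V : lmodType R) (N : set V) x y :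
  submod N -> N x -> N y -> N (x - y).
Proof. by case=> _ ND NZ hx hy; rewrite -scaleN1r; apply: ND => //; apply: NZ. Qed.

Lemma submod_sum (V : lmodType R) (N : set V) (I : Type) (r : seq I)
  (P : pred I) (F : I -> V) :
  submod N -> (forall i, P i -> N (F i)) -> N (\sum_(i <- r | P i) F i).
Proof. by case=> N0 ND _ h; apply: big_ind => //; exact: ND. Qed.

Lemma mpow_submod n : submod (M n : set R^o).
Proof. by split; [exact: mpow0|exact: mpowD|exact: mpowMl]. Qed.

Lemma inM_submod n p : submod (inM n : set 'rV[R]_p).
Proof. by split; [exact: inM0|exact: inMD|move=> a x; apply: inMZr]. Qed.

Lemma span_submod r p (S : 'M[R]_(r, p)) n :
  submod [set v | exists2 w : 'rV[R]_r, inM n w & v = w *m S].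
Proof.
split.
- by exists 0; [exact: inM0|rewrite mul0mx].
- move=> _ _ [w hw ->] [w' hw' ->]; exists (w + w'); last by rewrite mulmxDl.
  exact: inMD.
- move=> a _ [w hw ->]; exists (a *: w); last by rewrite scalemxAl.
  exact: inMZr.
Qed.

(** Gaussian elimination modulo m: a first column with entries in m is dropped, otherwise a unit
    entry of it serves as pivot. *)
Lemma linear_dependence n d (C : 'M[R]_(n, d)) : (d < n)%N ->
  exists c : 'rV[R]_n, (exists i, ~ M 1 (c 0 i)) /\ inM 1 (c *m C).
Proof.
elim: d n C => [|d IHd] [//|n] C lt_dn.
  exists (const_mx 1); split; last by move=> i [].
  by exists ord0; rewrite mxE mpow1; apply: maxidN1.
case: (pselect (forall i, M 1 (C i ord0))) => [C0|/existsNP[i0 /mpow1_noninv[u hu]]].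
  have [|c [ci hc]] := IHd _ (\matrix_(i, j) C i (lift ord0 j)); first exact: ltnW.
  exists c; split=> // i j; case: (unliftP ord0 j) => [k ->|->].
    move: (hc i k); rewrite !mxE; under eq_bigr do rewrite mxE; exact.
  by rewrite mxE; apply: mpow_sum => k _; apply: mpowMl.
pose C' := \matrix_(j < n, k < d)
  (C (lift i0 j) (lift ord0 k) - C (lift i0 j) ord0 * u * C i0 (lift ord0 k)).
have [|c' [[j0 cj0] hc']] := IHd _ C'; first by [].
pose c0 := - \sum_j c' 0 j * C (lift i0 j) ord0 * u.
exists (\row_k if unlift i0 k is Some j then c' 0 j else c0); split.
  by exists (lift i0 j0); rewrite mxE liftK.
move=> i l; rewrite mxE (bigD1_ord i0) //= mxE unlift_none.
under eq_bigr do rewrite mxE liftK.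
rewrite mulNr mulr_suml -sumrN -big_split /=.
case: (unliftP ord0 l) => [k ->|->].
  move: (hc' ord0 k); rewrite mxE; congr (M 1 _); apply: eq_bigr => j _.
  by rewrite mxE; ring.
rewrite big1; first exact: mpow0.
by move=> j _; rewrite -!mulrA [u * _]mulrC hu mulr1 addNr.
Qed.

Section FinKdim.
Variables (V : lmodType R) (N N' : set V).
Hypotheses (HN : submod N) (HN' : submod N').
Hypothesis mN : forall a x, M 1 a -> N x -> N' (a *: x).

(** The map f is injective modulo N', so a dependence among the images of a basis would be one among
    the basis. The identity gives uniqueness of dimensions, a chain map the comparison of Tor. *)
Lemma kdim_le_lin (W : lmodType R) (L L' : set W) (f : {linear W -> V}) d d' :
  submod L -> (forall x, L x -> N (f x)) -> (forall x, L x -> N' (f x) -> L' x) ->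
  has_kdim L L' d -> has_kdim N N' d' -> (d <= d')%N.
Proof.
move=> HL fL fL' [v [Lv _ vind]] [w [Nw wspan _]].
rewrite leqNgt; apply/negP => lt_dd'.
have [C hC] := choice_exists (fun i => wspan _ (fL _ (Lv i))).
have [c [[i ci] hc]] := linear_dependence (\matrix_(i, j) C i j) lt_dd'.
apply: ci; rewrite mpow1; apply: (vind (fun i => c 0 i)); apply: fL'.
  by apply: submod_sum => // k _; case: HL => _ _; apply.
have -> : f (\sum_i c 0 i *: v i) =
    \sum_i c 0 i *: (f (v i) - \sum_j C i j *: w j)
    + \sum_j (c *m \matrix_(i, j) C i j) 0 j *: w j.
  under [X in _ + X]eq_bigr do rewrite mxE scaler_suml.
  rewrite exchange_big -big_split /= linear_sum; apply: eq_bigr => k _.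
  rewrite linearZ /= scalerBr scaler_sumr -addrA -[LHS]addr0; congr (_ + _).
  rewrite addrC -sumrB big1 // => j _.
  by rewrite mxE scalerA subrr.
case: (HN') => _ ND NZ; apply: ND; apply: submod_sum => // k _; first exact: NZ.
by apply: mN => //; apply: hc.
Qed.

(** A generator that has a unit coefficient in some relation modulo N' is redundant and is
    discarded. *)
Lemma kdim_span n (v : 'I_n -> V) : (forall i, N (v i)) ->
  (forall x, N x -> exists c : 'I_n -> R, N' (x - \sum_i c i *: v i)) ->
  exists2 d, (d <= n)%N & has_kdim N N' d.
Proof.
elim: n v => [|n IHn] v Nv vspan.
  by exists 0%N => //; exists v; split=> // c _ [].
case: (pselect (forall c : 'I_n.+1 -> R, N' (\sum_i c i *: v i) -> forall i, m (c i))).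
  by move=> vind; exists n.+1 => //; exists v.
move=> /existsNP[c /not_implyP[Nc /existsNP[i0]]]; rewrite -mpow1 => /mpow1_noninv[u hu].
have [||d le_dn hd] := IHn (fun j => v (lift i0 j)) _; last by exists d => //; apply: leqW.
  by [].
move=> x /vspan[a ha]; exists (fun j => a (lift i0 j) - a i0 * u * c (lift i0 j)).
have -> : x - \sum_i (a (lift i0 i) - a i0 * u * c (lift i0 i)) *: v (lift i0 i) =
    (x - \sum_i a i *: v i) + (a i0 * u) *: \sum_i c i *: v i.
  rewrite [\sum_i a i *: v i](bigD1_ord i0) // [\sum_i c i *: v i](bigD1_ord i0) //=.
  rewrite scalerDr scalerA mulrAC -mulrA hu mulr1 opprD -!addrA; congr (_ + _).
  rewrite [X in - _ + X]addrCA addKr scaler_sumr -!sumrN -big_split.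
  by apply: eq_bigr => j _ /=; rewrite scalerBl scalerA opprB addrC.
by case: (HN') => _ ND NZ; apply: ND => //; apply: NZ.
Qed.

Lemma kdim_fin (T : finType) (v : T -> V) : (forall i, N (v i)) ->
  (forall x, N x -> exists c : T -> R, N' (x - \sum_i c i *: v i)) ->
  (forall c : T -> R, N' (\sum_i c i *: v i) -> forall i, m (c i)) ->
  has_kdim N N' #|T|.
Proof.
have enumE (F : T -> V) : \sum_i F i = \sum_(i < #|T|) F (enum_val i).
  by rewrite (reindex _ (onW_bij _ (@enum_val_bij T))).
move=> Nv vspan vind; exists (fun i => v (enum_val i)); split=> //.
- move=> x /vspan[c hc]; exists (fun i => c (enum_val i)).
  by rewrite -(enumE (fun i => c i *: v i)).
- move=> c hc i.
  rewrite -[i]enum_valK; apply: (vind (fun t => c (enum_rank t))).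
  rewrite enumE; move: hc; congr (N' _); apply: eq_bigr => j _.
  by rewrite enum_valK.
Qed.

End FinKdim.

Lemma kdim_unique (V : lmodType R) (N N' : set V) d d' :
  submod N -> submod N' -> (forall a x, M 1 a -> N x -> N' (a *: x)) ->
  has_kdim N N' d -> has_kdim N N' d' -> d = d'.
Proof.
move=> HN HN' mN h h'; apply/eqP; rewrite eqn_leq.
by rewrite !(@kdim_le_lin _ N N' HN' mN _ N N' idfun).
Qed.

(** Induction on p: the first coordinates of N form an ideal, and the vectors of N with first
    coordinate 0 form a submodule one rank lower. *)
Lemma submod_fg p (N : set 'rV[R]_p) : submod N ->
  exists n (S : 'M[R]_(n, p)), forall v, N v <-> exists w, v = w *m S.
Proof.
elim: p N => [|p IHp] N0 HN0.
  have [N00 _ _] := HN0; exists 0%N, 0 => v; split=> [_|_]; first by exists 0; apply/rowP => -[].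
  by have -> : v = 0 by apply/rowP => -[].
pose N : set 'rV[R]_(1 + p) := N0.
have HN : submod N := HN0.
have [NN0 ND NZ] := HN.
pose N1 := [set u : 'rV[R]_p | N (row_mx (0 : 'rV_1) u)].
have [|n1 [S1 hS1]] := IHp N1.
  split=> [|x y|a x]; rewrite /N1 /=.
  - by rewrite row_mx0.
  - by move=> hx /(ND _ _ hx); rewrite add_row_mx addr0.
  - by move=> /(NZ a); rewrite scale_row_mx scaler0.
pose I := [set x | exists2 v : 'rV[R]_(1 + p), N v & v 0 (lshift p 0) = x].
have HI : is_ideal I.
  split.
  - by exists 0; rewrite ?mxE.
  - by move=> _ _ [v hv <-] [w hw <-]; exists (v + w); rewrite ?mxE //; apply: ND.
  - by move=> a _ [v hv <-]; exists (a *: v); rewrite ?mxE //; apply: NZ.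
have [s Is] := @noetherianP R _ HI.
have Isi (i : 'I_(size s)) : exists v : 'rV[R]_(1 + p), N v /\ v 0 (lshift p 0) = s`_i.
  have : I s`_i.
    by rewrite Is; apply: nth_gen.
  by case=> v; exists v.
have [S0 hS0] := row_choice Isi.
exists (size s + n1)%N, (col_mx S0 (row_mx (0 : 'M_(n1, 1)) S1)) => v.
change (N v <-> exists w, v = w *m col_mx S0 (row_mx (0 : 'M_(n1, 1)) S1)).
change 'rV[R]_(1 + p) in v; split; last first.
  case=> w ->; rewrite -[w]hsubmxK mul_row_col; apply: ND.
    rewrite mulmx_sum_row; apply: submod_sum => // i _; apply: NZ.
    by case: (hS0 i).
  by rewrite mul_mx_row mulmx0; apply/hS1; exists (rsubmx w).
move=> Nv; have : I (v 0 (lshift p 0)) by exists v.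
rewrite Is => -[c hc].
pose w0 := \row_(i < size s) c i.
have Nw : N (w0 *m S0).
  by rewrite mulmx_sum_row; apply: submod_sum => // i _; apply: NZ; case: (hS0 i).
have : N1 (rsubmx (v - w0 *m S0)).
  rewrite /N1 /=; suff -> : 0 = lsubmx (v - w0 *m S0).
    by rewrite hsubmxK; apply: submodB.
  apply/rowP => i; rewrite ord1 !mxE hc -sumrB big1 // => j _.
  by rewrite mxE; have [_ ] := hS0 j; rewrite mxE => ->; rewrite subrr.
move=> /hS1[w1 hw1]; exists (row_mx w0 w1); rewrite mul_row_col.
rewrite mul_mx_row mulmx0 -hw1.
have -> : 0 = lsubmx (v - w0 *m S0).
  apply/rowP => i; rewrite ord1 !mxE hc -sumrB big1 // => j _.
  by rewrite mxE; have [_ ] := hS0 j; rewrite mxE => ->; rewrite subrr.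
by rewrite hsubmxK addrC subrK.
Qed.

Lemma minimal_generators p (N : set 'rV[R]_p) : submod N ->
  exists n (S : 'M[R]_(n, p)), (forall v, N v <-> exists w, v = w *m S) /\
    forall w : 'rV[R]_n, w *m S = 0 -> inM 1 w.
Proof.
move=> /submod_fg[n [S hS]]; elim: n S hS => [|n IHn] S hS.
  by exists 0%N, S; split=> // w _ i [].
case: (pselect (forall w : 'rV[R]_n.+1, w *m S = 0 -> inM 1 w)); first by exists n.+1, S.
move=> /existsNP[w /not_implyP[wS /existsNP[i /existsNP[i0]]]].
rewrite ord1 => /mpow1_noninv[u hu]; apply: (IHn (row' i0 S)) => v.
split=> [/hS[w' ->]|[w' ->]].
  exists (\row_j (w' 0 (lift i0 j) - w' 0 i0 * u * w 0 (lift i0 j))).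
  have -> : w' *m S = (w' - (w' 0 i0 * u) *: w) *m S.
    by rewrite mulmxBl -scalemxAl wS scaler0 subr0.
  apply/rowP => k; rewrite !mxE (bigD1_ord i0) //= !mxE.
  rewrite -mulrA [u * _]mulrC hu mulr1 subrr mul0r add0r.
  by apply: eq_bigr => j _; rewrite !mxE.
apply/hS; exists (\row_k if unlift i0 k is Some j then w' 0 j else 0).
apply/rowP => k; rewrite !mxE (bigD1_ord i0) //= !mxE unlift_none mul0r add0r.
by apply: eq_bigr => j _; rewrite !mxE liftK.
Qed.

(** Nakayama's lemma for nilpotent m: elements spanning m modulo m^2 approximate each element of m,
    with an error one power of m deeper at each round, hence generate m. *)
Lemma edim_kdim n : M n = [set 0] ->
  has_kdim (M 1 : set R^o) (M 2) (edim R).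
Proof.
move=> Mn0.
have nak d (v : 'I_d -> R^o) : (forall i, M 1 (v i)) ->
    (forall x, M 1 x -> exists c : 'I_d -> R, M 2 (x - \sum_i c i *: v i)) ->
    (edim R <= d)%N.
  move=> Mv vspan; rewrite /edim; case: ex_minnP => k _; apply.
  apply/asboolP; exists [seq v i | i <- enum 'I_d]; split.
    by rewrite size_map size_enum_ord.
  pose J := gen [seq v i | i <- enum 'I_d].
  have Jsum (c : 'I_d -> R) : J (\sum_i c i * v i).
    exists (fun k => if insub k is Some i then c i else 0).
    rewrite size_map size_enum_ord; apply: eq_bigr => i _.
    by rewrite valK (nth_map i) ?size_enum_ord // nth_ord_enum.
  have [J0 JD JM] := is_ideal_gen [seq v i | i <- enum 'I_d].
  have step j x : M j.+1 x -> exists2 y, J y & M j.+2 (x - y).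
    case=> l [a [b [hab ->]]].
    have hb i : exists c : 'I_d -> R, M 2 (a i - \sum_i c i *: v i).
      by apply: vspan; rewrite mpow1; case: (hab i).
    have [c hc] := choice_exists hb.
    exists (\sum_i b i * \sum_k c i k * v k).
      apply: is_ideal_sum => [|i]; first exact: is_ideal_gen.
      by apply: JM; apply: Jsum.
    rewrite -sumrB; apply: mpow_sum => i _.
    rewrite [b i * _]mulrC -mulrBl; apply: (@mpowM _ 2 j); first exact: hc.
    by case: (hab i).
  have all j x : M 1 x -> exists2 y, J y & M j.+1 (x - y).
    elim: j => [|j IHj] hx; first by exists 0 => //; rewrite subr0.
    have [y Jy /step[z Jz hz]] := IHj hx; exists (y + z); first exact: JD.
    by rewrite opprD addrA.
  apply/seteqP; split=> x.
    rewrite -mpow1 => /(all n)[y Jy].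
    move/(mpow_le (leqnSn n)); rewrite Mn0 => /eqP; rewrite subr_eq0 => /eqP->.
    exact: Jy.
  case=> c ->; apply: is_ideal_sum; first exact: maxid_ideal.
  move=> i; case: (maxid_ideal R) => _ _; apply.
  have lti : (i < size (enum 'I_d))%N by rewrite -(size_map v).
  have i' : 'I_d by move: lti; rewrite size_enum_ord => h; exact: (Ordinal h).
  by rewrite (nth_map i') // -mpow1; apply: Mv.
have [s [es ms]] : exists s, size s = edim R /\ maxid R = gen s.
  by rewrite /edim; case: ex_minnP => k /asboolP[s [? ?]] _; exists s.
have [||d le_d hd] := @kdim_span _ (M 1 : set R^o) (M 2) (mpow_submod 2) (size s) (fun i => s`_i).
- by move=> i; rewrite mpow1 ms; apply: nth_gen.
- move=> x; rewrite mpow1 {1}ms => -[c ->]; exists (fun i => c i).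
  by rewrite subrr; apply: mpow0.
suff -> : edim R = d by [].
apply/eqP; rewrite eqn_leq -{2}es le_d andbT.
by case: hd => v [Mv vspan _]; apply: nak Mv vspan.
Qed.

End Kdim.

(** * Exact zero divisors and the socle *)

Section Socle.
Variable R : localRingType.
Local Notation M := (idpow (maxid R)).
Hypothesis SI : baer (setT : set (R^o : lmodType R)).

(** Baer's criterion for the map r a |-> r c on the ideal (a). *)
Lemma baer_principal (a c : R) : (forall r, a * r = 0 -> c * r = 0) ->
  exists x, c = x * a.
Proof.
move=> h; have [|||e [_ _ he]] := @baer_ext R R^o setT [set 0] a c SI.
- by [].
- by split=> [|x y -> ->|r x ->] //=; rewrite ?addr0 ?mulr0.
- by move=> r /=; rewrite mulrC => /h hr; rewrite [LHS]mulrC.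
by exists e; rewrite -he mulrC.
Qed.

Variable s : R.
Hypotheses (M4 : M 4 = [set 0]) (M3s : M 3 s) (s_neq0 : s != 0).

Lemma mpow4_eq0 x : M 4 x -> x = 0. Proof. by rewrite M4. Qed.

Lemma socle_ann t : t * s = 0 -> M 1 t.
Proof.
move=> ts; case: (mpow_dichotomy t) => // -[t' e].
by move: s_neq0; rewrite -[s]mul1r -e mulrAC ts mul0r eqxx.
Qed.

Lemma socle_mul t : M 1 t -> t * s = 0.
Proof. by move=> mt; apply: mpow4_eq0; apply: (mpowM mt). Qed.

(** The annihilator of s lies in m, so it kills x, and [baer_principal] applies to s and x. *)
Lemma socle_gen x : (forall r, M 1 r -> x * r = 0) -> exists t, x = t * s.
Proof.
move=> hx; apply: baer_principal => r; rewrite mulrC => /socle_ann; exact: hx.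
Qed.

Lemma mpow3_socle x : M 3 x -> exists t, x = t * s.
Proof. by move=> hx; apply: socle_gen => r mr; apply/mpow4_eq0/(mpowM hx). Qed.

Lemma mpow3_scale y x : y * x != 0 -> M 3 (y * x) -> exists t, y * (t * x) = s.
Proof.
move=> n0 /mpow3_socle[t e]; case: (mpow_dichotomy t) => [/socle_mul|[t' e']].
  by rewrite -e => e0; rewrite e0 eqxx in n0.
by exists t'; rewrite mulrCA e mulrA [t' * t]mulrC e' mul1r.
Qed.

(** The source of every contradiction with embedding dimension at least 3. *)
Lemma edim_le_span2 (x y : R) : M 1 x -> M 1 y ->
  (forall z, M 1 z -> exists c d, M 2 (z - (c * x + d * y))) ->
  (edim R <= 2)%N.
Proof.
move=> mx my h.
pose v (i : 'I_2) : R^o := if val i == 0%N then x else y.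
have [||d le_d hd] := @kdim_span R R^o (M 1) (M 2) (mpow_submod R 2) 2 v.
- by move=> i; rewrite /v; case: ifP.
- move=> z /h[c [d hcd]]; exists (fun i => if val i == 0%N then c else d).
  by rewrite !big_ord_recl big_ord0 addr0.
suff -> : edim R = d by [].
apply: (kdim_unique (mpow_submod R 1) (mpow_submod R 2)) hd.
  by move=> a z ha hz; apply: (mpowM ha).
exact: edim_kdim M4.
Qed.

Hypothesis edim3 : (3 <= edim R)%N.

Section ExactPair.
Variables a b : R.
Hypotheses (ma : M 1 a) (mb : M 1 b).
Hypothesis annab : forall y, a * y = 0 -> exists u, y = b * u.

(* Otherwise x |-> a x maps m into the socle, so m is generated by b and one
   more element. *)
Lemma exact_mpow2_nonzero : exists w, M 2 w /\ a * w = s.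
Proof.
apply: contrapT => h.
have a2 w : M 2 w -> a * w = 0.
  move=> mw; apply/eqP; apply: contrapT => /negP n0.
  have [|t et] := mpow3_scale n0; first exact: (mpowM ma mw).
  by apply: h; exists (t * w); split=> //; apply: mpowMl.
have soc x : M 1 x -> exists t, a * x = t * s.
  by move=> mx; apply: socle_gen => r mr; rewrite -mulrA a2 //; apply: (mpowM mx).
suff: (edim R <= 2)%N by rewrite leqNgt edim3.
case: (pselect (exists2 x0, M 1 x0 & a * x0 != 0)) => [[x0 mx0 n0]|n0]; last first.
  apply: (edim_le_span2 mb mb) => z mz.
  have [|u ->] := annab (y := z).
    by apply/eqP; apply: contrapT => /negP nz; apply: n0; exists z.
  by exists u, 0; rewrite mul0r addr0 mulrC subrr; apply: mpow0.
have [t0 e0] := soc _ mx0.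
have [t0' et0] : exists t, t0 * t = 1.
  apply: mpow1_noninv => /socle_mul; rewrite -e0 => ax0.
  by rewrite ax0 eqxx in n0.
apply: (edim_le_span2 mb mx0) => z mz; have [t e] := soc _ mz.
have [|u hu] := annab (y := z - t * t0' * x0).
  rewrite mulrBr mulrCA e0 e -mulrA [t0' * _]mulrA [t0' * t0]mulrC et0 mul1r.
  exact: subrr.
exists u, (t * t0').
by rewrite [u * b]mulrC -hu subrK subrr; apply: mpow0.
Qed.

(** With w in m^2 and a w = s, the product r s = (r a) w lies in m^4 = 0, so r is no unit. *)
Lemma exact_notin_mpow2 r : M 2 (r * a) -> M 1 r.
Proof.
move=> h; have [w [mw aw]] := exact_mpow2_nonzero.
apply: socle_ann; rewrite -aw mulrA; exact/mpow4_eq0/(mpowM h mw).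
Qed.

End ExactPair.

Variables a b : R.
Hypotheses (ma : M 1 a) (mb : M 1 b).
Hypothesis annab : forall y, a * y = 0 -> exists u, y = b * u.
Hypothesis annba : forall y, b * y = 0 -> exists u, y = a * u.

(** The class of l in m/m^2 lies off the line k a. *)
Definition off_line l := M 1 l /\ forall c, ~ M 2 (l - c * a).

(** Otherwise b l kills m, so b l = t s = b (t v) with v in m^2; then l - t v is in 0 : b = (a),
    which puts l on the line modulo m^2. *)
Lemma off_line_pairing l : off_line l -> exists x, M 1 x /\ b * l * x = s.
Proof.
move=> [ml nl]; apply: contrapT => h.
have [v [mv bv]] := exact_mpow2_nonzero mb ma annba.
have [|t ht] := @socle_gen (b * l).
  move=> x mx; apply/eqP; apply: contrapT => /negP n0.
  have [|t et] := mpow3_scale n0; first exact: (mpowM (mpowM mb ml) mx).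
  by apply: h; exists (t * x); split=> //; apply: mpowMl.
have [|u hu] := annba (y := l - t * v).
  by rewrite mulrBr ht mulrCA bv subrr.
apply: (nl u); have -> : l - u * a = t * v by rewrite [u * a]mulrC -hu subKr.
exact: mpowMl.
Qed.

(** Both b y and b l x = s lie in the socle, so subtracting a multiple of l x moves y into 0 : b =
    (a). *)
Lemma off_line_mpow2 l y : off_line l -> M 2 y ->
  exists al ga, [/\ M 1 al, M 1 ga & y = l * al + a * ga].
Proof.
move=> ol my; have [x [mx bx]] := off_line_pairing ol; case: ol => ml nl.
have [t ht] : exists t, b * y = t * s by apply/mpow3_socle/(mpowM mb my).
have [|r hr] := annba (y := y - t * (l * x)).
  by rewrite mulrBr ht mulrCA [b * (l * x)]mulrA bx subrr.
exists (t * x), r; split; first exact: mpowMl.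
- apply: (exact_notin_mpow2 ma mb annab); rewrite mulrC -hr.
  by apply: mpowB => //; apply/mpowMl/(mpowM ml mx).
- by rewrite -hr; ring.
Qed.

(** If the kernel of z |-> b l z were on the line k a modulo m^2, then a and x would span m modulo
    m^2. An l' off the line in this kernel has l l' in 0 : b = (a). *)
Lemma off_line_mpow2_sum l : off_line l ->
  exists l' t, [/\ off_line l', M 1 t & l * l' = a * t].
Proof.
move=> ol; have [x [mx bx]] := off_line_pairing ol; case: ol => ml nl.
apply: contrapT => h; suff: (edim R <= 2)%N by rewrite leqNgt edim3.
have ker l' : M 1 l' -> b * l * l' = 0 -> exists c, M 2 (l' - c * a).
  move=> ml' bll'; apply: contrapT => nl'; apply: h.
  have [|r hr] := annba (y := l * l'); first by rewrite mulrA.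
  exists l', r; split=> //; first by split=> // c hc; apply: nl'; exists c.
  apply: (exact_notin_mpow2 ma mb annab); rewrite mulrC -hr.
  exact: (mpowM ml ml').
apply: (edim_le_span2 ma mx) => z mz.
have [t ht] : exists t, b * l * z = t * s.
  by apply/mpow3_socle/(mpowM (mpowM mb ml) mz).
have [||c hc] := ker (z - t * x).
- by apply: mpowB => //; apply: mpowMl.
- by rewrite mulrBr ht mulrCA bx subrr.
exists c, t; suff -> : z - (c * a + t * x) = z - t * x - c * a by [].
by ring.
Qed.

Lemma off_line_exists : exists l, off_line l.
Proof.
apply: contrapT => h; suff: (edim R <= 2)%N by rewrite leqNgt edim3.
apply: (edim_le_span2 ma ma) => z mz.
have [c hc] : exists c, M 2 (z - c * a).
  by apply: contrapT => nz; apply: h; exists z; split=> // c hc; apply: nz; exists c.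
by exists c, 0; rewrite mul0r addr0.
Qed.

(** Since c a is in the socle, c differs from a multiple of w in m^2 by an element b r of 0 : a;
    then c v = 0 reads r s = 0, which puts r in m. *)
Lemma ann_mpow2 c : (forall y, M 2 y -> c * y = 0) -> M 2 c.
Proof.
move=> c2; have [w [mw aw]] := exact_mpow2_nonzero ma mb annab.
have [v [mv bv]] := exact_mpow2_nonzero mb ma annba.
have [t ht] : exists t, c * a = t * s.
  by apply: socle_gen => r mr; rewrite -mulrA c2 //; apply: (mpowM ma mr).
have [|r hr] := annab (y := c - t * w).
  by rewrite mulrBr [a * c]mulrC ht mulrCA aw subrr.
have -> : c = b * r + t * w by rewrite -hr subrK.
apply: mpowD; last exact: mpowMl.
apply: (mpowM mb); apply: socle_ann; have: c * v = 0 by apply: c2.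
have -> : c = b * r + t * w by rewrite -hr subrK.
have wv0 : w * v = 0 by apply/mpow4_eq0/(mpowM mw mv).
by rewrite mulrDl mulrAC bv -mulrA wv0 mulr0 addr0 mulrC.
Qed.

End Socle.

Section DualBasis.
Variable R : localRingType.
Local Notation M := (idpow (maxid R)).
Variable s : R.
Hypothesis SI : baer (setT : set (R^o : lmodType R)).
Hypotheses (M4 : M 4 = [set 0]) (M3s : M 3 s) (s_neq0 : s != 0).
Hypothesis ann2 : forall c, (forall y, M 2 y -> c * y = 0) -> M 2 c.
Variables (e : nat) (x : 'I_e -> R).
Hypothesis Mx : forall i, M 1 (x i).
Hypothesis xspan : forall z, M 1 z -> exists c : 'I_e -> R, M 2 (z - \sum_i c i * x i).
Hypothesis xfree : forall c : 'I_e -> R, M 2 (\sum_i c i * x i) -> forall i, M 1 (c i).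

(** The j-th coordinate with respect to x, times s, is a linear map from m to R that kills m^2. By
    self-injectivity it is multiplication by some y, and y kills m^2, hence lies in m^2. *)
Lemma dual_basis : exists y : 'I_e -> R,
  (forall i, M 2 (y i)) /\ forall i j, x i * y j = (i == j)%:R * s.
Proof.
suff h j : exists y, M 2 y /\ forall i, x i * y = (i == j)%:R * s.
  by have [y hy] := choice_exists h; exists y; split=> [i|i j]; [exact: (hy i).1|exact: (hy j).2].
have cP z : exists c : 'I_e -> R, M 1 z -> M 2 (z - \sum_i c i * x i).
  case: (pselect (M 1 z)) => [/xspan[c hc]|?]; first by exists c.
  by exists (fun=> 0).
have [g hg] := choice_exists cP.
have gE z (c : 'I_e -> R) : M 1 z -> M 2 (z - \sum_i c i * x i) ->
    forall i, g z i * s = c i * s.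
  move=> mz hc i; apply/eqP; rewrite -subr_eq0 -mulrBl; apply/eqP.
  apply: (socle_mul M4 M3s); apply: (xfree (c := fun i => g z i - c i)).
  under eq_bigr do rewrite mulrBl.
  rewrite sumrB; have E (A B C : R) : A - B = (C - B) - (C - A) by ring.
  rewrite (E _ _ z).
  by apply: (mpowB hc); apply: hg.
have [||||y [_ hy]] := @SI (M 1) (fun z => g z j * s).
- exact: (is_ideal_pow 1 (maxid_ideal R)).
- by [].
- move=> z z' mz mz'; rewrite -mulrDl.
  apply: (gE _ (fun i => g z i + g z' i)); first exact: mpowD.
  under eq_bigr do rewrite mulrDl.
  rewrite big_split /=; have -> (A B C D : R) : A + B - (C + D) = (A - C) + (B - D) by ring.
  by apply: mpowD; apply: hg.
- move=> c z mz; rewrite [RHS]mulrA.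
  apply: (gE _ (fun i => c * g z i)); first exact: mpowMl.
  under eq_bigr do rewrite -mulrA.
  by rewrite -mulr_sumr -mulrBr; apply/mpowMl/hg.
exists y; split.
  apply: ann2 => z mz; rewrite mulrC.
  have mz1 : M 1 z by apply: mpow_le mz.
  have -> : z * y = g z j * s by rewrite (hy z mz1).
  rewrite (gE z (fun=> 0)) ?mul0r //.
  by under eq_bigr do rewrite mul0r; rewrite big1 // subr0.
move=> i; have -> : x i * y = g (x i) j * s by rewrite (hy _ (Mx i)).
apply: (gE _ (fun k => (i == k)%:R)) => //.
rewrite (bigD1 i) //= eqxx mul1r big1 ?addr0 ?subrr; first exact: mpow0.
by move=> k; rewrite eq_sym => /negPf->; rewrite mul0r.
Qed.

End DualBasis.

(** * The linear resolution *)

Section Resolution.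
Variable R : localRingType.
Local Notation M := (idpow (maxid R)).
Variables (a b s : R) (off : R -> Prop).

(** All that the induction on syzygies uses about the pair (a, b); [off] abstracts the elements of m
    off the line of a. *)
Record exact_pair_axioms : Prop := ExactPairAxioms {
  ep_ma : M 1 a;
  ep_mb : M 1 b;
  ep_ab : a * b = 0;
  ep_annab : forall y, a * y = 0 -> exists u, y = b * u;
  ep_annba : forall y, b * y = 0 -> exists u, y = a * u;
  ep_na : forall u, M 2 (a * u) -> M 1 u;
  ep_nb : forall u, M 2 (b * u) -> M 1 u;
  ep_soc : forall x, M 3 x -> exists t, x = t * s;
  ep_sa : exists2 w, M 2 w & a * w = s;
  ep_sb : exists2 v, M 2 v & b * v = s;
  ep_off : exists l, off l;
  ep_off_m : forall l, off l -> M 1 l;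
  ep_off2 : forall l y, off l -> M 2 y ->
    exists al ga, [/\ M 1 al, M 1 ga & y = l * al + a * ga];
  ep_off_mul : forall l, off l ->
    exists l' t, [/\ off l', M 1 t & l * l' = a * t] }.

(** The module m^n N, where N is the row module of S. *)
Definition imM n r p (S : 'M[R]_(r, p)) (v : 'rV[R]_p) : Prop :=
  exists2 w : 'rV[R]_r, inM n w & v = w *m S.

(* The invariant carried along the resolution: N is the image of S, D says
   m N = l N + a N for l off the line k a, X says that (a, b) stays an exact
   pair on m N, and T bounds the degree of m^2 N and of m^3 R^p. *)
Record linear_syzygy r p (S : 'M[R]_(r, p)) : Prop := LinearSyzygy {
  ls_in : inM 1 S;
  ls_min : forall u : 'rV[R]_r, u *m S = 0 -> inM 1 u;
  ls_D : forall l (al : 'rV[R]_r), off l -> inM 1 al ->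
    exists y y' : 'rV[R]_r, al *m S = (l *: y + a *: y') *m S;
  ls_Xa : forall u : 'rV[R]_r, inM 1 u -> a *: (u *m S) = 0 ->
    exists n : 'rV[R]_r, u *m S = b *: (n *m S);
  ls_Xb : forall u : 'rV[R]_r, inM 1 u -> b *: (u *m S) = 0 ->
    exists n : 'rV[R]_r, u *m S = a *: (n *m S);
  ls_Ta : forall u : 'rV[R]_r, inM 2 u ->
    exists2 q : 'rV[R]_r, inM 1 q & u *m S = a *: (q *m S);
  ls_Tb : forall u : 'rV[R]_r, inM 2 u ->
    exists2 q : 'rV[R]_r, inM 1 q & u *m S = b *: (q *m S);
  ls_soc : forall y : 'rV[R]_p, inM 3 y -> imM 2 S y }.

(** The second clause is linearity: the elements of the syzygy module N' inside m^2 R^r already lie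
    in m N'. *)
Definition syzygy_of r' r p (S' : 'M[R]_(r', r)) (S : 'M[R]_(r, p)) : Prop :=
  (forall v : 'rV[R]_r, v *m S = 0 <-> exists w, v = w *m S') /\
  (forall y : 'rV[R]_r, inM 2 y -> y *m S = 0 -> imM 1 S' y).

Hypothesis E : exact_pair_axioms.

Lemma row_ann c d n (y : 'rV[R]_n) :
  (forall y, c * y = 0 -> exists u, y = d * u) -> c *: y = 0 ->
  exists u : 'rV[R]_n, y = d *: u.
Proof.
move=> h cy; have [i j|u hu] := @mx_choice R 1 n (fun i j u => y i j = d * u).
  by apply: h; move/matrixP/(_ i j): cy; rewrite !mxE.
by exists u; apply/matrixP => i j; rewrite mxE.
Qed.

Lemma row_off2 l n (y : 'rV[R]_n) : off l -> inM 2 y ->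
  exists al ga : 'rV[R]_n, [/\ inM 1 al, inM 1 ga & y = l *: al + a *: ga].
Proof.
move=> ol my.
have [i j|al hal] := @mx_choice R 1 n (fun i j al => M 1 al /\ exists2 ga, M 1 ga & y i j = l * al + a * ga).
  by have [al [ga [? ? ?]]] := ep_off2 E ol (my i j); exists al; split=> //; exists ga.
have [i j|ga hga] := @mx_choice R 1 n (fun i j ga => M 1 ga /\ y i j = l * al i j + a * ga).
  by have [_ [ga ? ?]] := hal i j; exists ga.
exists al, ga; split=> [i j|i j|]; [exact: (hal i j).1|exact: (hga i j).1|].
by apply/matrixP => i j; rewrite !mxE; exact: (hga i j).2.
Qed.

Lemma row_mpow3 c n (y : 'rV[R]_n) : (exists2 w, M 2 w & c * w = s) -> inM 3 y ->
  exists2 u : 'rV[R]_n, inM 2 u & y = c *: u.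
Proof.
move=> [w mw cw] my.
have [i j|u hu] := @mx_choice R 1 n (fun i j u => M 2 u /\ y i j = c * u).
  have [t ->] := ep_soc E (my i j); exists (t * w); split; first exact: mpowMl.
  by rewrite mulrCA cw.
exists u; first by move=> i j; exact: (hu i j).1.
by apply/matrixP => i j; rewrite mxE; exact: (hu i j).2.
Qed.

Lemma linear_syzygy_step r p (S : 'M[R]_(r, p)) : linear_syzygy S ->
  exists r' (S' : 'M[R]_(r', r)), linear_syzygy S' /\ syzygy_of S' S.
Proof.
move=> LS.
pose N := [set v : 'rV[R]_r | v *m S = 0].
have [|r' [S' [hS' minS']]] := @minimal_generators R r N.
  split=> [|x y|c x]; rewrite /N /=; first by rewrite mul0mx.
    by rewrite mulmxDl => -> ->; rewrite addr0.
  by rewrite -scalemxAl => ->; rewrite scaler0.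
have S'0 (w : 'rV_r') : w *m S' *m S = 0 by apply/(hS' (w *m S')); exists w.
have mS' : inM 1 S'.
  move=> i j; have := ls_min LS (S'0 (delta_mx 0 i)) 0 j.
  by rewrite -rowE mxE.
(* Write y = b u. As u S is killed by b, it is a n S, so u - a n is a syzygy, and b (u - a n) = y
   because a b = 0. *)
have Xa (y : 'rV_r) : inM 2 y -> y *m S = 0 -> a *: y = 0 -> exists n, y = b *: (n *m S').
  move=> my yS ay; have [u yu] := row_ann (ep_annab E) ay.
  have mu : inM 1 u by move=> i j; apply: (ep_nb E); move: (my i j); rewrite yu mxE.
  have [|n hn] := ls_Xb LS mu; first by rewrite scalemxAl -yu.
  have [n' hn'] : exists n', u - a *: n = n' *m S'.
    by apply/(hS' (u - a *: n)); rewrite /N /= mulmxBl hn scalemxAl subrr.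
  exists n'; rewrite -hn' scalerBr scalerA [b * a]mulrC (ep_ab E) scale0r subr0.
  exact: yu.
have Xb (y : 'rV_r) : inM 2 y -> y *m S = 0 -> b *: y = 0 -> exists n, y = a *: (n *m S').
  move=> my yS ay; have [u yu] := row_ann (ep_annba E) ay.
  have mu : inM 1 u by move=> i j; apply: (ep_na E); move: (my i j); rewrite yu mxE.
  have [|n hn] := ls_Xa LS mu; first by rewrite scalemxAl -yu.
  have [n' hn'] : exists n', u - b *: n = n' *m S'.
    by apply/(hS' (u - b *: n)); rewrite /N /= mulmxBl hn scalemxAl subrr.
  exists n'; rewrite -hn' scalerBr scalerA (ep_ab E) scale0r subr0.
  exact: yu.
(* The hypothesis on S is applied to l' rather than l: multiplying al - (l' y1 + a y2), a syzygy, by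
   l turns the term in l' into a multiple of a, because l l' = a t. *)
have D l (y : 'rV_r) : off l -> inM 2 y -> y *m S = 0 ->
    exists n n', y = (l *: n + a *: n') *m S'.
  move=> ol my yS; have [al [ga [mal mga yE]]] := row_off2 ol my.
  have [l' [t [ol' mt ll']]] := ep_off_mul E ol.
  have [y1 [y2 h12]] := ls_D LS ol' mal.
  have [n hn] : exists n, al - (l' *: y1 + a *: y2) = n *m S'.
    by apply/(hS' (al - _)); rewrite /N /= mulmxBl h12 subrr.
  (* What remains of y after removing l times that syzygy is a g; exactness on m N replaces g by a
     syzygy without changing a g. *)
  pose g := ga + t *: y1 + l *: y2.
  have mg : inM 1 g.
    apply: inMD; last exact/inMZl/(ep_off_m E).
    by apply: inMD => //; apply: inMZl.
  have yE2 : y = l *: (n *m S') + a *: g.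
    rewrite -hn yE /g; apply/matrixP => i j; rewrite !mxE.
    have -> : l * (al i j - (l' * y1 i j + a * y2 i j)) +
        a * (ga i j + t * y1 i j + l * y2 i j) =
        l * al i j + a * ga i j - (l * l' - a * t) * y1 i j by ring.
    by rewrite ll' subrr mul0r subr0.
  have agS : a *: (g *m S) = 0.
    have := yS; rewrite yE2 mulmxDl -!scalemxAl S'0 scaler0 add0r; exact.
  have [n1 hn1] := ls_Xa LS mg agS.
  have [n2 hn2] : exists n2, g - b *: n1 = n2 *m S'.
    by apply/(hS' (g - _)); rewrite /N /= mulmxBl hn1 scalemxAl subrr.
  exists n, n2; rewrite mulmxDl -!scalemxAl -hn2 scalerBr scalerA (ep_ab E).
  by rewrite scale0r subr0.
have L1 (y : 'rV_r) : inM 2 y -> y *m S = 0 -> imM 1 S' y.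
  move=> my yS; have [l ol] := ep_off E; have [n [n' ->]] := D _ _ ol my yS.
  exists (l *: n + a *: n') => //.
  by apply: inMD; apply: inMZl; [exact: ep_off_m|exact: ep_ma].
(* All of m^3 R^r is reached: y = a u with u in m^2, and u is corrected by b q, invisible to a, to
   become a syzygy in m^2. *)
have Ta (y : 'rV_r) : inM 3 y -> exists2 q, inM 1 q & y = a *: (q *m S').
  move=> /(row_mpow3 (ep_sa E))[u mu ->].
  have [q mq hq] := ls_Tb LS mu.
  have [||w mw hw] := L1 (u - b *: q).
  - by apply: inMB => //; apply: (inMZ (ep_mb E)).
  - by rewrite mulmxBl hq scalemxAl subrr.
  by exists w => //; rewrite -hw scalerBr scalerA (ep_ab E) scale0r subr0.
have Tb (y : 'rV_r) : inM 3 y -> exists2 q, inM 1 q & y = b *: (q *m S').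
  move=> /(row_mpow3 (ep_sb E))[u mu ->].
  have [q mq hq] := ls_Ta LS mu.
  have [||w mw hw] := L1 (u - a *: q).
  - by apply: inMB => //; apply: (inMZ (ep_ma E)).
  - by rewrite mulmxBl hq scalemxAl subrr.
  by exists w => //; rewrite -hw scalerBr scalerA [b * a]mulrC (ep_ab E) scale0r subr0.
exists r', S'; split; last first.
  split=> // v; exact: hS'.
split=> //.
- move=> l al ol mal; apply: D => //; exact: (inMM mal mS').
- by move=> u mu; apply: Xa => //; apply: (inMM mu mS').
- by move=> u mu; apply: Xb => //; apply: (inMM mu mS').
- by move=> u mu; apply: Ta; apply: (inMM mu mS').
- by move=> u mu; apply: Tb; apply: (inMM mu mS').
- move=> y /Ta[q mq ->]; exists (a *: q); last by rewrite scalemxAl.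
  exact: (inMZ (ep_ma E)).
Qed.

(** Here N is m itself, so m^n N = m^(n+1) and the axioms on elements of R apply coordinatewise. *)
Lemma linear_syzygy_start e (S : 'M[R]_(e, 1)) :
  inM 1 S -> (forall u : 'rV[R]_e, u *m S = 0 -> inM 1 u) ->
  (forall n (y : 'rV[R]_1), inM n.+1 y -> imM n S y) -> linear_syzygy S.
Proof.
move=> mS minS genS.
have im n (u : 'rV[R]_e) : inM n u -> inM n.+1 (u *m S).
  by move=> mu; rewrite -addn1; apply: inMM.
have scal c n (y : 'rV[R]_1) : inM n.+1 y -> exists2 w : 'rV[R]_e, inM n w & c *: y = c *: (w *m S).
  by move=> /genS[w mw ->]; exists w.
split=> //.
- move=> l al ol /im; have [_|] := ltnP 1 2 => // /(row_off2 ol)[y [y' [my my' ->]]].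
  have [w _ ->] := scal l 0%N _ my; have [w' _ ->] := scal a 0%N _ my'.
  by exists w, w'; rewrite mulmxDl !scalemxAl.
- move=> u /im mu /(row_ann (ep_annab E))[n hn].
  have mn : inM 1 n by move=> i j; apply: (ep_nb E); move: (mu i j); rewrite hn mxE.
  by have [w _ hw] := scal b 0%N _ mn; exists w; rewrite hn hw.
- move=> u /im mu /(row_ann (ep_annba E))[n hn].
  have mn : inM 1 n by move=> i j; apply: (ep_na E); move: (mu i j); rewrite hn mxE.
  by have [w _ hw] := scal a 0%N _ mn; exists w; rewrite hn hw.
- by move=> u /im/(row_mpow3 (ep_sa E))[n mn ->]; apply: scal.
- by move=> u /im/(row_mpow3 (ep_sb E))[n mn ->]; apply: scal.
- exact: genS.
Qed.

End Resolution.

(** Dependent choice for matrices whose sizes must match. The sizes are packed with the matrix so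
    that the row count of each one is, by conversion, the column count of the next. *)
Lemma matrix_chain (A : nzRingType)
  (P0 : forall r p, 'M[A]_(r, p) -> Prop)
  (P : nat -> forall r p, 'M[A]_(r, p) -> Prop)
  (Q : forall r' r p, 'M[A]_(r', r) -> 'M[A]_(r, p) -> Prop) r0 p0 (S0 : 'M[A]_(r0, p0)) :
  (forall n r p (S : 'M[A]_(r, p)), P n r p S ->
     exists r' (S' : 'M[A]_(r', r)), P n.+1 r' r S' /\ Q r' r p S' S) ->
  P0 _ _ S0 -> P 0%N _ _ S0 ->
  exists (b : nat -> nat) (D : forall i, 'M[A]_(b i.+1, b i)),
    [/\ P0 _ _ (D 0%N), forall i, P i _ _ (D i) & forall i, Q _ _ _ (D i.+1) (D i)].
Proof.
move=> step P0S PS.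
pose T n := {rp : nat * nat & {S : 'M[A]_(rp.1, rp.2) | P n _ _ S}}.
pose next n (x : T n) := cid (step n _ _ _ (svalP (projT2 x))).
pose next2 n (x : T n) := cid (svalP (next n x)).
pose nxt n (x : T n) : T n.+1 :=
  existT _ (sval (next n x), (projT1 x).1)
    (exist _ (sval (next2 n x)) (svalP (next2 n x)).1).
pose F := fix F n : T n := if n is k.+1 then nxt k (F k)
  else existT _ (r0, p0) (exist _ S0 PS).
exists (fun i => (projT1 (F i)).2), (fun i => sval (projT2 (F i))); split=> //.
- by move=> i; exact: (svalP (projT2 (F i))).
- move=> i; exact: (svalP (next2 i (F i))).2.
Qed.

(** * Dimension counts along the linear resolution *)

Section Betti.
Variable R : localRingType.
Local Notation m := (maxid R).
Local Notation M := (idpow (maxid R)).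

Lemma kdim_rows j h r : has_kdim (M j : set R^o) (M j.+1) h ->
  has_kdim (inM j : set 'rV[R]_r) (inM j.+1) (r * h).
Proof.
move=> [v [Mv vspan vind]].
have -> : (r * h)%N = #|{: 'I_r * 'I_h}| by rewrite card_prod !card_ord.
pose f (t : 'I_r * 'I_h) : 'rV[R]_r := v t.2 *: delta_mx 0 t.1.
have fE (c : 'I_r * 'I_h -> R) i0 i :
    (\sum_t c t *: f t) i0 i = \sum_k c (i, k) * v k.
  have -> : \sum_t c t *: f t = \sum_i \sum_k c (i, k) *: f (i, k).
    by rewrite pair_bigA; apply: eq_bigr => -[].
  rewrite summxE (bigD1 i) //= [X in _ + X]big1 ?addr0.
    rewrite summxE; apply: eq_bigr => k _.
    by rewrite /f !mxE ord1 !eqxx mulr1.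
  move=> l nl; rewrite summxE big1 // => k _.
  by rewrite /f !mxE ord1 eqxx /= eq_sym (negPf nl) !mulr0.
apply: (kdim_fin (v := f)).
- by move=> t; apply: inMZl; apply: Mv.
- move=> x Mx; have [i|c hc] := @choice_exists _ _ (fun i (c : 'I_h -> R) => M j.+1 (x 0 i - \sum_k c k *: v k)).
    exact: vspan.
  exists (fun t => c t.1 t.2) => i0 i; rewrite 2!mxE fE ord1; exact: hc.
- move=> c hc [i k]; apply: (vind (fun k => c (i, k))).
  by move: (hc 0 i); rewrite fE.
Qed.

Section Step.
Variables (e r p : nat) (S : 'M[R]_(r, p)).
Hypothesis M4 : M 4 = [set 0].
Hypothesis k1 : has_kdim (M 1 : set R^o) (M 2) e.
Hypothesis k2 : has_kdim (M 2 : set R^o) (M 3) e.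
Variables (a b s : R) (off : R -> Prop).
Hypothesis E : exact_pair_axioms a b s off.
Hypothesis LS : linear_syzygy a b off S.

Lemma kdim_image : exists d, has_kdim (imM 1 S) (imM 2 S) d.
Proof.
have [v [Mv vspan vind]] := kdim_rows r k1.
have [||d _ hd] := @kdim_span _ _ (imM 1 S) (imM 2 S) (span_submod S 2) _ (fun i => v i *m S).
- by move=> i; exists (v i).
- move=> _ [w mw ->]; have [c hc] := vspan w mw; exists c.
  exists (w - \sum_i c i *: v i) => //.
  by rewrite mulmxBl mulmx_suml; congr (_ - _); apply: eq_bigr => i _; rewrite scalemxAl.
by exists d.
Qed.

(** The matrix W lifts s times the identity through S. Its rows split off m^3 R^p in [kdim_second]
    and become the copies of k over R/m^3. *)
Lemma socle_lift : M 3 s -> exists2 W : 'M[R]_(p, r), inM 2 W & W *m S = s%:M.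
Proof.
move=> Ms; have [j|W hW] := @row_choice R p r (fun j w => inM 2 w /\ w *m S = s *: delta_mx 0 j).
  have [|w mw hw] := ls_soc LS (y := s *: delta_mx 0 j); first exact: inMZl.
  by exists w.
exists W; first by move=> i j; move: ((hW i).1 0 j); rewrite mxE.
apply/row_matrixP => j; rewrite row_mul (hW j).2.
by apply/rowP => k; rewrite !mxE eqxx /= eq_sym mulr_natr.
Qed.

Variables (r' : nat) (S' : 'M[R]_(r', r)).
Hypothesis LS' : linear_syzygy a b off S'.
Hypothesis SY : syzygy_of S' S.

(** With N and N' the row modules of S and S', this counts dimensions in 0 -> N'/m N' -> m R^r/m^2
    R^r -> m N/m^2 N -> 0, exact on the left by linearity. *)
Lemma kdim_first d : has_kdim (imM 1 S) (imM 2 S) d -> (r * e = r' + d)%N.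
Proof.
move=> [v [/= Mv vspan vind]].
have [j|u hu] := @choice_exists _ _ (fun j u => inM 1 u /\ v j = u *m S).
  by have [w mw ->] := Mv j; exists w.
apply: (kdim_unique (inM_submod R 1 r) (inM_submod R 2 r)).
- by move=> x y mx my; apply: (inMZ mx my).
- exact: kdim_rows k1.
have -> : (r' + d)%N = #|{: 'I_r' + 'I_d}| by rewrite card_sum !card_ord.
pose f (t : 'I_r' + 'I_d) : 'rV[R]_r :=
  match t with inl i => row i S' | inr j => u j end.
have fE (c : 'I_r' + 'I_d -> R) : \sum_t c t *: f t =
    (\row_i c (inl i)) *m S' + \sum_j c (inr j) *: u j.
  rewrite big_sumType mulmx_sum_row; congr (_ + _).
  by apply: eq_bigr => i _; rewrite mxE.
have fS c : (\sum_j c j *: u j) *m S = \sum_j c j *: v j.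
  by rewrite mulmx_suml; apply: eq_bigr => j _; rewrite -scalemxAl; have [_ <-] := hu j.
have S'0 (w : 'rV_r') : w *m S' *m S = 0 by apply/SY.1; exists w.
apply: (kdim_fin (v := f)).
- case=> [i|j] /=; last by have [] := hu j.
  by move=> k l; rewrite mxE; apply: (ls_in LS').
- move=> x mx; have [|c [t mt ht]] := vspan (x *m S); first by exists x.
  have [w hw] : exists w, x - \sum_j c j *: u j - t = w *m S'.
    by apply/SY.1; rewrite !mulmxBl fS ht subrr.
  exists (fun t => match t with inl i => w 0 i | inr j => c j end).
  rewrite fE; have -> : \row_i w 0 i = w by apply/rowP => i; rewrite mxE.
  suff -> : x - (w *m S' + \sum_j c j *: u j) = t by [].
  by rewrite -hw addrAC subrK subKr.
- move=> c hc.
  have cr j : m (c (inr j)).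
    apply: (vind (fun j => c (inr j))); exists (\sum_t c t *: f t) => //.
    by rewrite fE mulmxDl S'0 add0r fS.
  have [||w mw hw] := SY.2 (\row_i c (inl i) *m S').
  - have -> : \row_i c (inl i) *m S' = \sum_t c t *: f t - \sum_j c (inr j) *: u j.
      by rewrite fE addrK.
    apply: inMB => //; apply: submod_sum; first exact: inM_submod.
    move=> j _; apply: (@inMZ _ 1 1); first by rewrite mpow1.
    by have [] := hu j.
  - exact: S'0.
  case=> [i|j] //; rewrite -mpow1.
  have := ls_min LS' (u := \row_i c (inl i) - w).
  rewrite mulmxBl hw subrr => /(_ erefl) /inMD/(_ mw); rewrite subrK => /(_ 0 i).
  by rewrite mxE.
Qed.

(** Dimensions in 0 -> m N'/m^2 N' -> m^2 R^r/m^3 R^r -> m^3 R^p -> 0. Injectivity holds as m^3 R^r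
    lies in m^2 N', and W lifts a basis of m^3 R^p. *)
Lemma kdim_second d : has_kdim (imM 1 S') (imM 2 S') d -> s != 0 -> M 3 s ->
  (r * e = d + p)%N.
Proof.
move=> [v [/= Mv vspan vind]] s0 Ms.
have Mv2 j : inM 2 (v j) by have [w mw ->] := Mv j; apply: (inMM mw (ls_in LS')).
have vS j : v j *m S = 0 by have [w mw ->] := Mv j; apply/SY.1; exists w.
have [W mW WS] := socle_lift Ms.
apply: (kdim_unique (inM_submod R 2 r) (inM_submod R 3 r)).
- by move=> x y mx my; apply: (inMZ mx my).
- exact: kdim_rows k2.
have -> : (d + p)%N = #|{: 'I_d + 'I_p}| by rewrite card_sum !card_ord.
pose f (t : 'I_d + 'I_p) : 'rV[R]_r :=
  match t with inl i => v i | inr j => row j W end.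
have fE (c : 'I_d + 'I_p -> R) : \sum_t c t *: f t =
    \sum_j c (inl j) *: v j + (\row_i c (inr i)) *m W.
  rewrite big_sumType mulmx_sum_row; congr (_ + _).
  by apply: eq_bigr => i _; rewrite mxE.
have fS c : (\sum_j c j *: v j) *m S = 0.
  by rewrite mulmx_suml big1 // => j _; rewrite -scalemxAl vS scaler0.
apply: (kdim_fin (v := f)).
- by case=> [i|j] //= k l; rewrite mxE; apply: mW.
- move=> x mx.
  have [j|t ht] := @choice_exists _ _ (fun j t => (x *m S) 0 j = t * s).
    exact/(ep_soc E)/(inMM mx (ls_in LS)).
  have xW : (x - (\row_j t j) *m W) *m S = 0.
    rewrite mulmxBl -mulmxA WS mul_mx_scalar; apply/rowP => j.
    by rewrite mxE ht !mxE mulrC subrr.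
  have [|w mw hw] := SY.2 _ _ xW.
    by apply: inMB => //; apply: inMMl.
  have [|c [w' mw' hc]] := vspan (w *m S'); first by exists w.
  exists (fun t0 => match t0 with inl i => c i | inr j => t j end).
  rewrite fE; have -> : x - (\sum_j c j *: v j + \row_i t i *m W) = w' *m S'.
    by rewrite -hc -hw opprD addrA addrAC.
  exact: (inMM mw' (ls_in LS')).
- move=> c hc.
  have cr j : M 1 (c (inr j)).
    have : (\sum_t c t *: f t) *m S = 0.
      by apply/rowP => k; rewrite [RHS]mxE; apply: (mpow4_eq0 M4); apply: (inMM hc (ls_in LS)).
    rewrite fE mulmxDl fS add0r -mulmxA WS mul_mx_scalar => /rowP/(_ j).
    rewrite !mxE mulrC; exact: (socle_ann s0).
  case=> [i|j]; last by rewrite -mpow1.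
  apply: (vind (fun i => c (inl i))).
  have : inM 3 (\sum_j c (inl j) *: v j).
    have -> : \sum_j c (inl j) *: v j = \sum_t c t *: f t - \row_i c (inr i) *m W.
      by rewrite fE addrK.
    apply: inMB => //; apply: (@inMM _ 1 2) => // i' j; by rewrite mxE.
  exact: (ls_soc LS').
Qed.

End Step.

End Betti.

(** * Betti numbers and Tor *)

Section TorBetti.
Variable A : localRingType.
Local Notation m := (maxid A).
Local Notation M := (idpow (maxid A)).

Section Compare.
Variables (b b' : nat -> nat).
Variables (D : forall i, 'M[A]_(b i.+1, b i)) (D' : forall i, 'M[A]_(b' i.+1, b' i)).
Variables (c : 'cV[A]_(b 0%N)) (c' : 'cV[A]_(b' 0%N)).
Hypothesis F : free_resolution m D c.
Hypothesis F' : free_resolution m D' c'.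

Lemma resolution_comp i : D i.+1 *m D i = 0.
Proof.
case: F => _ _ ex; apply/row_matrixP => j; rewrite row_mul row0.
by apply/ex; exists (delta_mx 0 j); rewrite rowE.
Qed.

Lemma resolution_lift i k (X : 'M[A]_(k, b i.+1)) :
  X *m D i = 0 -> exists Y, X = Y *m D i.+1.
Proof.
case: F => _ _ ex XD.
have [j|Y hY] := @row_choice A k _ (fun j w => row j X = w *m D i.+1).
  by apply/ex; rewrite -row_mul XD row0.
by exists Y; apply/row_matrixP => j; rewrite hY row_mul.
Qed.

Lemma resolution_lift0 k (X : 'M[A]_(k, b 0)) :
  (forall j, m ((X *m c) j 0)) -> exists Y, X = Y *m D 0%N.
Proof.
case: F => _ ex _ XD.
have [j|Y hY] := @row_choice A k _ (fun j w => row j X = w *m D 0%N).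
  by apply/ex; rewrite -row_mul mxE.
by exists Y; apply/row_matrixP => j; rewrite hY row_mul.
Qed.

Lemma resolution_aug : inM 1 (D 0%N *m c).
Proof.
case: F => _ ex _ j k; rewrite ord1 mpow1.
have -> : (D 0%N *m c) j 0 = (row j (D 0%N) *m c) 0 0 by rewrite -row_mul [RHS]mxE.
by apply/ex; exists (delta_mx 0 j); rewrite rowE.
Qed.

Lemma aug_lift : exists ph : 'M[A]_(b 0, b' 0), inM 1 (ph *m c' - c).
Proof.
case: F' => -[v hv] _ _; exists (c *m v).
rewrite -mulmxA -[X in _ - X]mulmx1 -mulmxBr; apply: inMMl => i j.
rewrite !ord1; suff -> : (v *m c' - 1%:M) 0 0 = (v *m c') 0 0 - 1 by rewrite mpow1.
by rewrite !mxE eqxx.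
Qed.

End Compare.

Section Betti.
Variables (b b' : nat -> nat).
Variables (D : forall i, 'M[A]_(b i.+1, b i)) (D' : forall i, 'M[A]_(b' i.+1, b' i)).
Variables (c : 'cV[A]_(b 0%N)) (c' : 'cV[A]_(b' 0%N)).
Hypothesis F : free_resolution m D c.
Hypothesis F' : free_resolution m D' c'.

(** The comparison of resolutions in degrees n and n + 1. The homotopy is built on the side of D
    only: it yields one inequality of Betti numbers, and exchanging the resolutions yields the
    other. *)
Lemma chain_homotopy n : exists ph ph1 ps ps1 s s1,
  [/\ D n *m ph = ph1 *m D' n, D' n *m ps = ps1 *m D n
    & 1%:M - ph1 *m ps1 = s1 *m D n.+1 + D n *m s].
Proof.
elim: n => [|n [ph [ph1 [ps [ps1 [s [s1 [h h' hs]]]]]]]].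
  have [ph hph] := aug_lift c F'; have [ps hps] := aug_lift c' F.
  have [|ph1 h1] := resolution_lift0 F' (X := D 0%N *m ph).
    move=> j; rewrite -mpow1 -mulmxA -[ph *m c'](subrK c) mulmxDr.
    by apply: inMD; [apply: inMMl|apply: (resolution_aug F)].
  have [|ps1 h1'] := resolution_lift0 F (X := D' 0%N *m ps).
    move=> j; rewrite -mpow1 -mulmxA -[ps *m c](subrK c') mulmxDr.
    by apply: inMD; [apply: inMMl|apply: (resolution_aug F')].
  have [|s hs] := resolution_lift0 F (X := 1%:M - ph *m ps).
    move=> j; rewrite -mpow1 mulmxBl mul1mx -mulmxA.
    have -> : c - ph *m (ps *m c) = - (ph *m (ps *m c - c') + (ph *m c' - c)).
      by rewrite mulmxBr addrA subrK opprB.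
    by apply/inMN/inMD => //; apply: inMMl.
  have [|s1 hs1] := resolution_lift F (X := 1%:M - ph1 *m ps1 - D 0%N *m s).
    rewrite !mulmxBl mul1mx -!mulmxA -h1' -hs mulmxBr mulmx1 mulmxA -h1 -mulmxA.
    by rewrite subrr.
  by exists ph, ph1, ps, ps1, s, s1; split=> //; rewrite -hs1 subrK.
have [|ph2 h2] := resolution_lift F' (X := D n.+1 *m ph1).
  by rewrite -mulmxA -h mulmxA (resolution_comp F) mul0mx.
have [|ps2 h2'] := resolution_lift F (X := D' n.+1 *m ps1).
  by rewrite -mulmxA -h' mulmxA (resolution_comp F') mul0mx.
have [|s2 hs2] := resolution_lift F (X := 1%:M - ph2 *m ps2 - D n.+1 *m s1).
  rewrite !mulmxBl mul1mx -!mulmxA -h2' [ph2 *m (_ *m _)]mulmxA -h2 -[_ *m ph1 *m _]mulmxA.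
  rewrite -[X in X - _ - _]mulmx1 -!mulmxBr hs addrAC subrr add0r.
  by rewrite mulmxA (resolution_comp F) mul0mx.
by exists ph1, ph2, ps1, ps2, s1, s2; split=> //; rewrite -hs2 subrK.
Qed.

Lemma tor_cycles_submod n : submod (tor_cycles D n.+1).
Proof.
split=> [l|x y hx hy l|a x hx l] /=; rewrite -mpow1.
- by rewrite mul0mx mxE; apply: mpow0.
- by rewrite mulmxDl mxE; apply: mpowD; rewrite mpow1.
- by rewrite -scalemxAl mxE; apply: mpowMl; rewrite mpow1.
Qed.

Lemma tor_boundaries_submod n : submod (tor_boundaries D n).
Proof.
split=> [|x y [w hw] [w' hw']|a x [w hw]] /=.
- by exists 0 => l; rewrite mul0mx subr0 mxE -mpow1; apply: mpow0.
- exists (w + w') => l; rewrite -mpow1.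
  by rewrite mulmxDl opprD addrACA mxE; apply: mpowD; rewrite mpow1.
- exists (a *: w) => l; rewrite -mpow1.
  by rewrite -scalemxAl -scalerBr mxE; apply: mpowMl; rewrite mpow1.
Qed.

Lemma tor_mul n a x : M 1 a -> tor_cycles D n x -> tor_boundaries D n (a *: x).
Proof.
by move=> ma _; exists 0 => l; rewrite mul0mx subr0 mxE -mpow1; apply: mpowMr.
Qed.

End Betti.

(** The map induced by [ph1] on Tor is injective, [ph1 *m ps1] being homotopic to the identity. *)
Lemma tor_betti_le (b b' : nat -> nat)
  (D : forall i, 'M[A]_(b i.+1, b i)) (D' : forall i, 'M[A]_(b' i.+1, b' i))
  (c : 'cV[A]_(b 0%N)) (c' : 'cV[A]_(b' 0%N)) n d d' :
  free_resolution m D c -> free_resolution m D' c' ->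
  has_kdim (tor_cycles D n.+1) (tor_boundaries D n.+1) d ->
  has_kdim (tor_cycles D' n.+1) (tor_boundaries D' n.+1) d' -> (d <= d')%N.
Proof.
move=> F F'; have [ph [ph1 [ps [ps1 [s [s1 [h h' hs]]]]]]] := chain_homotopy F F' n.
apply: (@kdim_le_lin _ _ _ _ (tor_boundaries_submod D' n.+1) _ _ _ _ (mulmxr ph1)).
- exact: tor_mul.
- exact: tor_cycles_submod.
- move=> x hx l /=; rewrite -mulmxA -h mulmxA -mpow1; apply: inMMr => i j.
  by rewrite ord1 mpow1; apply: hx.
- move=> x hx [w hw].
  have [|w' hw'] := resolution_lift F (X := w *m D' n.+1 *m ps1).
    by rewrite -!mulmxA -h' [D' n.+1 *m _]mulmxA (resolution_comp F') mul0mx mulmx0.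
  exists (w' + x *m s1) => l.
  have -> : x - (w' + x *m s1) *m D n.+1 =
      (x *m ph1 - w *m D' n.+1) *m ps1 + x *m D n *m s.
    rewrite mulmxDl -hw' mulmxBl -[x *m s1 *m _]mulmxA -[x *m D n *m s]mulmxA.
    have -> : D n *m s = 1%:M - ph1 *m ps1 - s1 *m D n.+1 by rewrite hs addrC addKr.
    rewrite !mulmxBr mulmx1 [x *m (ph1 *m _)]mulmxA opprD addrA.
    by rewrite [RHS]addrC [RHS]addrA [X in _ = X - _]addrAC subrK addrAC.
  rewrite -mpow1; apply: inMD; apply: inMMr => i j; rewrite ord1 mpow1.
    exact: hw.
  exact: hx.
Qed.

Lemma tor_betti_unique (b b' : nat -> nat)
  (D : forall i, 'M[A]_(b i.+1, b i)) (D' : forall i, 'M[A]_(b' i.+1, b' i))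
  (c : 'cV[A]_(b 0%N)) (c' : 'cV[A]_(b' 0%N)) n d d' :
  free_resolution m D c -> free_resolution m D' c' ->
  has_kdim (tor_cycles D n.+1) (tor_boundaries D n.+1) d ->
  has_kdim (tor_cycles D' n.+1) (tor_boundaries D' n.+1) d' -> d = d'.
Proof.
move=> F F' h h'; apply/eqP; rewrite eqn_leq.
by rewrite (tor_betti_le F F' h h') (tor_betti_le F' F h' h).
Qed.

Lemma tor_betti_minimal (b : nat -> nat) (D : forall i, 'M[A]_(b i.+1, b i)) n :
  (forall i, inM 1 (D i)) ->
  has_kdim (tor_cycles D n) (tor_boundaries D n) (b n).
Proof.
move=> mD; exists (fun i => delta_mx 0 i); split.
- move=> i; case: n i => //= n i l; rewrite -mpow1; exact: inMMl.
- move=> x _; exists (fun i => x 0 i); exists 0 => l.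
  rewrite mul0mx subr0 -[X in X - _]mulmx1 -mpow1.
  suff -> : x *m 1%:M - \sum_i x 0 i *: delta_mx 0 i = 0 :> 'rV_(b n).
    by rewrite mxE; apply: mpow0.
  by rewrite mulmx1 [X in X - _]row_sum_delta subrr.
- move=> c [w hw] i.
  have := hw i; rewrite -mpow1.
  have -> : \sum_i c i *: delta_mx 0 i = \row_i c i :> 'rV[A]_(b n).
    by rewrite [RHS]row_sum_delta; apply: eq_bigr => k _; rewrite mxE.
  rewrite mxE [in X in X + _]mxE => h.
  rewrite -[c i](subrK ((w *m D n) 0 i)); apply: mpowD; last exact: inMMl.
  by move: h; rewrite mxE.
Qed.

End TorBetti.

(** * The quotient by the cube of the maximal ideal *)

Section QuotientResolution.
Variable R : localRingType.
Local Notation M := (idpow (maxid R)).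
Local Notation Q := {ideal_quot (mpow R 3)}.
Local Notation pi := (\pi_Q%qT : R -> Q).
Local Notation MQ := (idpow (maxid Q)).

Lemma pi_eq0 x : pi x = 0 <-> M 3 x.
Proof.
rewrite -(rmorph0 pi); split=> [/eqP|h].
  by rewrite -Quotient.idealrBE subr0 => /asboolP.
by apply/eqP; rewrite -Quotient.idealrBE subr0; apply/asboolP.
Qed.

Lemma pi_mpow1 x : MQ 1 (pi x) <-> M 1 x.
Proof.
rewrite !mpow1; split=> [[y my /eqP]|mx]; last by exists x.
rewrite eq_sym -Quotient.idealrBE => /asboolP h.
by rewrite -[x](subrK y) -mpow1; apply: mpowD; [apply: mpow_le h|rewrite mpow1].
Qed.

Lemma pi_mx_lift p q (A : 'M[Q]_(p, q)) : exists B : 'M[R]_(p, q), A = map_mx pi B.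
Proof. by exists (map_mx repr A); apply/matrixP => i j; rewrite !mxE reprK. Qed.

Lemma pi_mx_eq0 p q (A : 'M[R]_(p, q)) : map_mx pi A = 0 <-> inM 3 A.
Proof.
split=> [/matrixP h i j|h]; first by apply/pi_eq0; move: (h i j); rewrite !mxE.
by apply/matrixP => i j; rewrite !mxE; apply/pi_eq0.
Qed.

Lemma pi_mx_mpow1 p q (A : 'M[R]_(p, q)) : inM 1 (map_mx pi A) <-> inM 1 A.
Proof.
by split=> h i j; move: (h i j); rewrite mxE => /pi_mpow1.
Qed.

Variables (b : nat -> nat) (D : forall i, 'M[R]_(b i.+1, b i)).
Variables (s : R) (W : forall i, 'M[R]_(b i, b i.+1)).
Hypothesis M4 : M 4 = [set 0].
Hypotheses (M3s : M 3 s) (s0 : s != 0) (soc : forall x, M 3 x -> exists t, x = t * s).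
Hypothesis mD : forall i, inM 1 (D i).
Hypothesis exD : forall i (v : 'rV[R]_(b i.+1)), v *m D i = 0 <-> exists w, v = w *m D i.+1.
Hypothesis mW : forall i, inM 2 (W i).
Hypothesis WD : forall i, W i *m D i = s%:M.
(** These identify R^(b 0) with R, [b 0] not being convertible to 1. *)
Variables (C : 'M[R]_(b 0, 1)) (C' : 'M[R]_(1, b 0)).
Hypotheses (CC' : C *m C' = 1%:M).
Hypothesis gen0 : forall y : 'rV[R]_1, inM 1 y -> exists w, y = w *m (D 0%N *m C).
Local Notation bD i := (map_mx pi (D i)).
Local Notation bW i := (map_mx pi (W i)).

Lemma socle_row i (v : 'rV[R]_(b i.+1)) : inM 3 (v *m D i) ->
  exists t, v *m D i = (t *m W i) *m D i.
Proof.
move=> h; have [i0 j|t ht] := @mx_choice R 1 _ (fun i0 j t => (v *m D i) i0 j = t * s).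
  exact/soc/h.
exists t; rewrite -mulmxA WD mul_mx_scalar; apply/matrixP => i0 j.
by rewrite ht mxE mulrC.
Qed.

(** If v D_i vanishes modulo m^3, it is s t = (t W_i) D_i for some t, so v - t W_i is a cycle over
    R. *)
Lemma ker_bar i (v : 'rV[Q]_(b i.+1)) : v *m bD i = 0 <->
  exists w : 'rV_(b i.+2 + b i), v = w *m col_mx (bD i.+1) (bW i).
Proof.
split=> [|[w ->]].
  have [{}v ->] := pi_mx_lift v; rewrite -map_mxM => /pi_mx_eq0/socle_row[t ht].
  have [u hu] : exists u, v - t *m W i = u *m D i.+1.
    by apply/exD; rewrite mulmxBl ht subrr.
  exists (row_mx (map_mx pi u) (map_mx pi t)).
  by rewrite mul_row_col -!map_mxM -hu -map_mxD subrK.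
rewrite -[w]hsubmxK mul_row_col mulmxDl.
have [u ->] := pi_mx_lift (lsubmx w); have [t ->] := pi_mx_lift (rsubmx w).
rewrite -!map_mxM -map_mxD; apply/pi_mx_eq0; apply: inMD.
  have -> : u *m D i.+1 *m D i = 0 by apply/exD; exists u.
  exact: inM0.
by rewrite -mulmxA WD; apply: inMMl => k l; rewrite mxE; case: eqP => _; [|exact: mpow0].
Qed.

(** The two families of generators are independent and the rows of W_i span copies of k: multiplying
    a relation in m^3 by D_i leaves s t = 0, so t has entries in m. *)
Lemma ker_col i (u : 'rV[Q]_(b i.+2)) (t : 'rV[Q]_(b i)) :
  u *m bD i.+1 + t *m bW i = 0 <-> u *m bD i.+1 = 0 /\ inM 1 t.
Proof.
have [{}u ->] := pi_mx_lift u; have [{}t ->] := pi_mx_lift t.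
rewrite -!map_mxM -map_mxD; split=> [/pi_mx_eq0 h|[/pi_mx_eq0 hu /pi_mx_mpow1 ht]].
  have mt : inM 1 t.
    have h0 : (u *m D i.+1 + t *m W i) *m D i = 0.
      by apply/matrixP => k l; rewrite [RHS]mxE; apply/(mpow4_eq0 M4)/(inMM h).
    move: h0; rewrite mulmxDl.
    have -> : u *m D i.+1 *m D i = 0 by apply/exD; exists u.
    rewrite add0r -mulmxA WD mul_mx_scalar => /matrixP h0 k l.
    by apply: (socle_ann s0); move: (h0 k l); rewrite !mxE mulrC.
  split; last exact/pi_mx_mpow1.
  apply/pi_mx_eq0; rewrite -[_ *m _](addrK (t *m W i)); apply: inMB => //.
  exact: (inMM mt).
by apply/pi_mx_eq0/inMD => //; apply: (inMM ht).
Qed.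

(* (quotient_betti n).1 i and (quotient_betti n).2 are the n-th Betti numbers over
   R/m^3 of the kernel of the i-th reduced differential and of the maximal ideal. *)
Fixpoint quotient_betti n : (nat -> nat) * nat :=
  if n is n'.+1 then
    (fun i => (quotient_betti n').1 i.+1 + b i * (quotient_betti n').2,
     (quotient_betti n').1 0)%N
  else (fun i => b i.+2 + b i, b 1)%N.
Local Notation kap i := (fun n => (quotient_betti n).1 i).
Local Notation mu := (fun n => (quotient_betti n).2).

(* Up to isomorphism all syzygies of k over R/m^3 are direct sums of copies of
   its maximal ideal and of the kernels of the reduced differentials; the last
   argument lists the Betti numbers. *)
Inductive quotient_syzygy : forall p, set 'rV[Q]_p -> (nat -> nat) -> Prop :=
| QKer i : quotient_syzygy [set v | v *m bD i = 0] (kap i)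
| QMax : quotient_syzygy (inM 1 : set 'rV[Q]_1) mu
| QNil : quotient_syzygy (setT : set 'rV[Q]_0) (fun=> 0%N)
| QSum p q (N : set 'rV[Q]_p) (N' : set 'rV[Q]_q) be be' :
    quotient_syzygy N be -> quotient_syzygy N' be' ->
    quotient_syzygy [set v : 'rV[Q]_(p + q) | N (lsubmx v) /\ N' (rsubmx v)]
      (fun n => be n + be' n)%N.

Lemma quotient_syzygy_max q :
  quotient_syzygy (inM 1 : set 'rV[Q]_q) (fun n => q * mu n)%N.
Proof.
elim: q => [|q IHq].
  have -> : (inM 1 : set 'rV[Q]_0) = setT by apply/seteqP; split=> v _ // i [].
  exact: QNil.
have := QSum QMax IHq.
have -> // : [set v : 'rV[Q]_(1 + q) | inM 1 (lsubmx v) /\ inM 1 (rsubmx v)] = inM 1.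
apply/seteqP; split=> v /=; last first.
  by move=> h; split=> i j; rewrite mxE; apply: h.
case=> hl hr i j; rewrite -[v]hsubmxK -(splitK j); case: (split j) => k /=.
  by rewrite row_mxEl; apply: hl.
by rewrite row_mxEr; apply: hr.
Qed.

(** The first syzygy of the i-th kernel is the next kernel plus [b i] copies of m, that of m is the
    kernel with index 0, and sums go blockwise. *)
Lemma quotient_syzygy_step p (N : set 'rV[Q]_p) be : quotient_syzygy N be ->
  exists T : 'M[Q]_(be 0, p), [/\ forall v, N v <-> exists w, v = w *m T, inM 1 T
    & quotient_syzygy [set w : 'rV_(be 0%N) | w *m T = 0] (fun n => be n.+1)].
Proof.
elim=> {p N be} [i|||p q N N' be be' _ [T [hT mT IH]] _ [T' [hT' mT' IH']]].
- exists (col_mx (bD i.+1) (bW i)); split.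
  + exact: ker_bar.
  + move=> k l; rewrite mxE; case: (split k) => k'; rewrite mxE; apply/pi_mpow1.
      exact: mD.
    by apply: (@mpow_le _ 1 2) => //; apply: mW.
  + have := QSum (QKer i.+1) (quotient_syzygy_max (b i)).
    have -> // : [set v : 'rV[Q]_(b i.+2 + b i) | lsubmx v *m bD i.+1 = 0 /\
        inM 1 (rsubmx v)] = [set w : 'rV[Q]_(b i.+2 + b i) | w *m col_mx (bD i.+1) (bW i) = 0].
    have colE (v : 'rV[Q]_(b i.+2 + b i)) : v *m col_mx (bD i.+1) (bW i) =
        lsubmx v *m bD i.+1 + rsubmx v *m bW i by rewrite -{1}[v]hsubmxK mul_row_col.
    by apply/seteqP; split=> v /=; rewrite colE => /ker_col.
- exists (map_mx pi (D 0%N *m C) : 'M[Q]_(b 1, 1)); split.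
  + move=> v; have [{}v ->] := pi_mx_lift v; split=> [/pi_mx_mpow1/gen0[w ->]|[w ->]].
      by exists (map_mx pi w); rewrite map_mxM.
    by apply: inMMl; apply/pi_mx_mpow1; apply: inMMr; apply: mD.
  + by apply/pi_mx_mpow1; apply: inMMr; apply: mD.
  + have := QKer 0; have -> // : [set v : 'rV[Q]_(b 1) | v *m bD 0%N = 0] =
        [set w : 'rV[Q]_(b 1) | w *m map_mx pi (D 0%N *m C) = 0].
    apply/seteqP; split=> v /=; rewrite map_mxM mulmxA => h; first by rewrite h mul0mx.
    by rewrite -[LHS]mulmx1 -(map_mx1 pi) -CC' map_mxM mulmxA h mul0mx.
- exists 0; split.
  + by move=> v; split=> // _; exists 0; apply/rowP => -[].
  + exact: inM0.
  + have -> : [set w : 'rV[Q]_0 | w *m 0 = 0 :> 'rV[Q]_0] = (setT : set 'rV[Q]_0).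
      by apply/seteqP; split=> v // _; apply: mulmx0.
    exact: QNil.
- exists (block_mx T 0 0 T'); split.
  + move=> v; split=> [[/= /hT[w hw] /hT'[w' hw']]|[w ->]].
      exists (row_mx w w'); rewrite mul_row_block !mulmx0 addr0 add0r -hw -hw'.
      by rewrite hsubmxK.
    rewrite -[w]hsubmxK mul_row_block !mulmx0 addr0 add0r /= row_mxKl row_mxKr.
    by split; [apply/hT; exists (lsubmx w)|apply/hT'; exists (rsubmx w)].
  + move=> k l; rewrite mxE; case: (split k) => k'; rewrite mxE; case: (split l) => l' //.
      by rewrite mxE; apply: mpow0.
    by rewrite mxE; apply: mpow0.
  + have := QSum IH IH'.
    have -> // : [set v : 'rV[Q]_(be 0 + be' 0)%N | lsubmx v *m T = 0 /\ rsubmx v *m T' = 0]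
       = [set w : 'rV[Q]_(be 0 + be' 0)%N | w *m block_mx T 0 0 T' = 0].
    have blockE (v : 'rV[Q]_(be 0 + be' 0)%N) : v *m block_mx T 0 0 T' =
        row_mx (lsubmx v *m T) (rsubmx v *m T').
      by rewrite -{1}[v]hsubmxK mul_row_block !mulmx0 addr0 add0r.
    apply/seteqP; split=> v /=; rewrite blockE; first by case=> -> ->; rewrite row_mx0.
    by rewrite -(row_mx0 _ 1 p q) => /eq_row_mx.
Qed.

Lemma quotient_resolution :
  exists (bQ : nat -> nat) (DQ : forall i, 'M[Q]_(bQ i.+1, bQ i)) (c : 'cV[Q]_(bQ 0%N)),
  [/\ free_resolution (maxid Q) DQ c, forall i, inM 1 (DQ i) & forall i, bQ i.+1 = mu i].
Proof.
have [T0 [hT0 mT0 K0]] := quotient_syzygy_step QMax.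
(* The shift by n.+1 ties the Betti numbers of the n-th kernel to those of m, and so fixes the sizes
   of all later matrices. *)
pose P n r p (T : 'M[Q]_(r, p)) := exists be, [/\ quotient_syzygy [set w : 'rV_r | w *m T = 0] be,
   forall j, be j = mu (n.+1 + j)%N, r = mu n & inM 1 T].
pose P0 r p (T : 'M[Q]_(r, p)) := exists c : 'cV[Q]_p,
  (exists v : 'rV_p, maxid Q ((v *m c) 0 0 - 1)) /\
  forall v : 'rV_p, maxid Q ((v *m c) 0 0) <-> exists w, v = w *m T.
pose QQ r' r p (T' : 'M[Q]_(r', r)) (T : 'M[Q]_(r, p)) :=
  forall v : 'rV_r, v *m T = 0 <-> exists w, v = w *m T'.
have [||| bQ [DQ [[c [c1 hc]] hP hQ]]] := @matrix_chain Q P0 P QQ _ _ T0.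
- move=> n r p T [be [K hbe _ _]].
  have [T' [hT' mT' K']] := quotient_syzygy_step K.
  exists (be 0%N), T'; split; last by move=> v; apply: hT'.
  exists (fun n => be n.+1); split=> //.
    by move=> j; rewrite hbe addnS addSn.
  by have := hbe 0%N; rewrite addn0.
- exists 1%:M; split.
    by exists 1%:M; rewrite mulmx1 mxE eqxx subrr -mpow1; apply: mpow0.
  move=> v; rewrite mulmx1 -mpow1; split=> [h|/hT0]; last exact.
  by apply/hT0 => i j; rewrite !ord1.
- by exists (fun n => mu n.+1); split.
- exists bQ, DQ, c; split.
  + by split=> // i v; apply: hQ.
  + by move=> i; have [be [_ _ _ ?]] := hP i.
  + by move=> i; have [be [_ _ ? _]] := hP i.
Qed.

End QuotientResolution.

(** * Power series modulo a power of X, and the Poincare series *)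

Definition eqcoef N (p q : {poly int}) := forall n, (n < N)%N -> p`_n = q`_n.

Lemma eqcoefM N p q p' q' :
  eqcoef N p p' -> eqcoef N q q' -> eqcoef N (p * q) (p' * q').
Proof.
move=> hp hq n hn; rewrite !coefM; apply: eq_bigr => i _.
by rewrite hp ?hq //; have := ltn_ord i; lia.
Qed.

Lemma eqcoefD N p q p' q' :
  eqcoef N p p' -> eqcoef N q q' -> eqcoef N (p + q) (p' + q').
Proof. by move=> hp hq n hn; rewrite !coefD hp ?hq. Qed.

Lemma eqcoef_trans N p q r : eqcoef N p q -> eqcoef N q r -> eqcoef N p r.
Proof. by move=> h h' n hn; rewrite h ?h'. Qed.

Lemma eqcoef_sym N p q : eqcoef N p q -> eqcoef N q p.
Proof. by move=> h n hn; rewrite h. Qed.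

Lemma quotient_bettiE (b : nat -> nat) i n : (quotient_betti b n).1 i =
  (b (i + n).+2 + b (i + n) + \sum_(j < n) b (i + j) * (quotient_betti b (n.-1 - j)).2)%N.
Proof.
elim: n i => [|n IHn] i; first by rewrite /= addn0 big_ord0 addn0.
rewrite [LHS]/= IHn big_ord_recl /= subn0 addn0 addSnnS -!addnA.
congr (_ + (_ + _))%N; rewrite addnC; congr (_ + _)%N.
by apply: eq_bigr => j _; rewrite addSnnS; congr (_ * (quotient_betti b _).2)%N; rewrite /bump /=; lia.
Qed.

(* With B the Poincare series of R and P that of R/m^3, the hypotheses on d give
   B (1 - e z + e z^2 - z^3) = 1 and P = B + z^2 B P, hence
   P (1 - e z + (e - 1) z^2 - z^3) = 1. A Golod denominator has degree at most
   e' + 1, but it would be this cubic times (1 + z)^e'. *)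
Lemma betti_not_golod (b d P : nat -> nat) (e e' : nat) (q : {poly int}) :
  b 0%N = 1%N -> b 1%N = e -> d 0%N = e ->
  (forall i, b i.+1 * e = b i.+2 + d i)%N ->
  (forall i, b i.+1 * e = d i.+1 + b i)%N ->
  P 0%N = 1%N -> (forall i, P i.+1 = (quotient_betti b i).2) ->
  q`_(e' + 3) = 0 ->
  (forall n, \sum_(i < n.+1) (P i)%:Z * q`_(n - i) = ((1 + 'X) ^+ e' : {poly int})`_n) ->
  False.
Proof.
move=> b0 b1 d0 hd hd' P0 PS q0 hq.
(* The contradiction sits in degree e' + 3. *)
pose N := (e' + 4)%N.
pose B := \poly_(i < N) (b i)%:Z; pose A := \poly_(i < N) (P i)%:Z.
pose pR : {poly int} := 1 - e%:Z *: 'X + e%:Z *: 'X^2 - 'X^3.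
have bz i : (b i.+3)%:Z - e%:Z * (b i.+2)%:Z + e%:Z * (b i.+1)%:Z - (b i)%:Z = 0 :> int.
  by have := hd i.+1; have := hd' i; lia.
have hB : eqcoef N (B * pR) 1.
  move=> n hn; rewrite /pR !(mulrDr, mulrN, mulr1) -!scalerAr.
  rewrite !coefD !coefN !coefZ coefMX !coefMXn coef1 !coef_poly hn.
  case: n hn => [|[|[|n]]] hn /=.
  - by rewrite b0; lia.
  - by rewrite b0 b1 (leq_trans _ hn) //; lia.
  - have -> : (0 < N)%N by lia.
    have -> : (1 < N)%N by lia.
    by have := hd 0%N; rewrite d0 b1 b0; lia.
  - have -> : (n.+2 < N)%N by lia.
    have -> : (n.+3 - 2 < N)%N by lia.
    have -> : (n.+3 - 3 < N)%N by lia.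
    by rewrite !subSS !subn0; have := bz n; lia.
(* The lone summand b n of [quotient_bettiE] is b n P 0, the missing last term of the
   convolution. *)
have PE n : P n.+2 = (b n.+2 + \sum_(j < n.+1) b j * P (n - j))%N.
  rewrite PS /= quotient_bettiE add0n -addnA; congr (_ + _)%N.
  rewrite big_ord_recr /= subnn P0 muln1 addnC; congr (_ + _)%N.
  apply: eq_bigr => j _; rewrite add0n; congr (_ * _)%N.
  by rewrite -PS; congr P; have := ltn_ord j; lia.
have hA : eqcoef N A (B + 'X^2 * (B * A)).
  move=> n hn; rewrite coefD mulrC coefMXn !coef_poly hn.
  case: n hn => [|[|n]] hn; first by rewrite P0 b0 addr0.
    by rewrite PS addr0.
  rewrite !ltnS ltn0 PE PoszD; congr (_ + _); rewrite !subSS subn0 coefM.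
  rewrite (big_morph Posz PoszD (erefl (Posz 0))); apply: eq_bigr => j _.
  rewrite !coef_poly PoszM; have := ltn_ord j => hj.
  have -> : (j < N)%N by lia.
  by have -> : (n - j < N)%N by lia.
pose p : {poly int} := pR - 'X^2.
have hAp : eqcoef N (A * p) 1.
  have h1 : eqcoef N (A * pR) (1 + 'X^2 * A).
    apply: eqcoef_trans (eqcoefM hA (fun n _ => erefl _)) _.
    have -> : (B + 'X^2 * (B * A)) * pR = B * pR + 'X^2 * (B * pR * A) by ring.
    apply: eqcoefD => //; apply: eqcoefM => //.
    by rewrite -[X in eqcoef _ _ X]mul1r; apply: eqcoefM.
  rewrite /p mulrBr.
  have -> : 1 = 1 + 'X^2 * A - A * 'X^2 :> {poly int} by ring.
  by apply: eqcoefD.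
have hAq : eqcoef N (A * q) ((1 + 'X) ^+ e').
  move=> n hn; rewrite -hq coefM; apply: eq_bigr => j _.
  rewrite coef_poly; have := ltn_ord j => hj.
  by have -> : (j < N)%N by lia.
(* The series A inverts p, so it can be cancelled from A q = (1 + X)^e'. *)
have key : eqcoef N q ((1 + 'X) ^+ e' * p).
  have h1 : eqcoef N (q * (A * p)) (q * 1) by apply: eqcoefM.
  have h2 : eqcoef N (A * q * p) ((1 + 'X) ^+ e' * p) by apply: eqcoefM.
  rewrite mulr1 in h1; apply: eqcoef_trans (eqcoef_sym h1) _.
  by have -> : q * (A * p) = A * q * p by ring.
(* In this degree only -X^3 times the leading term of (1 + X)^e' contributes, giving -1 against
   0. *)
have := key (e' + 3)%N; rewrite q0 /p /pR => /(_ _)/esym.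
have mon : (1 + 'X : {poly int}) ^+ e' \is monic.
  by rewrite monic_exp // addrC -[1]/(1%:P) monicXaddC.
have sz : size ((1 + 'X : {poly int}) ^+ e') = e'.+1.
  have := size_exp ('X + 1%:P : {poly int}) e'; rewrite size_XaddC mul1n => h.
  rewrite addrC -[1]/(1%:P) -{2}h prednK // lt0n size_poly_eq0.
  by rewrite monic_neq0 // monic_exp // monicXaddC.
have lc : ((1 + 'X : {poly int}) ^+ e')`_e' = 1.
  by move/monicP: mon; rewrite /lead_coef sz.
rewrite !(mulrDr, mulrN, mulr1) -!scalerAr !coefD !coefN !coefZ coefMX !coefMXn.
have big k : (e' < k)%N -> ((1 + 'X : {poly int}) ^+ e')`_k = 0.
  by move=> hk; rewrite nth_default // sz.
have -> : (e' + 3 == 0)%N = false by lia.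
have -> : (e' + 3 < 2)%N = false by lia.
have -> : (e' + 3 < 3)%N = false by lia.
rewrite addnK lc !big; try lia.
Qed.

(** * The associated graded ring *)

Section Graded.
Variable R : localRingType.
Local Notation M := (idpow (maxid R)).
Local Notation G := (assoc_graded R).
Local Notation pi := (\pi_{ideal_quot (@rees_ideal R)}%qT : rees R -> G).

(* The class of x in m^n / m^(n+1). Outside m^n, insubd falls back to 0. *)
Definition gr (n : nat) (x : R) : G := pi (insubd (0 : rees R) (x *: 'X^n)).

Lemma val_gr n x : M n x -> val (insubd (0 : rees R) (x *: 'X^n)) = x *: 'X^n.
Proof.
move=> mx; rewrite val_insubd; suff -> : (x *: 'X^n) \in @rees_pred R by [].
apply/asboolP => i; rewrite coefZ coefXn; case: eqP => [->|_].
  exact: mpowMr.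
by rewrite mulr0; apply: mpow0.
Qed.

Lemma pi_gr_eq0 p : pi p = 0 <-> forall i, M i.+1 (val p)`_i.
Proof.
rewrite -(rmorph0 pi); split=> [/eqP|h].
  by rewrite -Quotient.idealrBE subr0 => /asboolP.
by apply/eqP; rewrite -Quotient.idealrBE subr0; apply/asboolP.
Qed.

Lemma gr_grade n x : assoc_grade n (gr n x).
Proof.
exists (insubd (0 : rees R) (x *: 'X^n)) => // i ni; rewrite val_insubd.
by case: ifP => _; rewrite ?coef0 // coefZ coefXn (negPf ni) mulr0.
Qed.

Lemma grD n x y : M n x -> M n y -> gr n (x + y) = gr n x + gr n y.
Proof.
move=> mx my; rewrite /gr -rmorphD; congr pi; apply: val_inj.
rewrite rmorphD /= !val_gr ?scalerDl //; exact: mpowD.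
Qed.

Lemma gr0 n : gr n 0 = 0.
Proof.
rewrite /gr -(rmorph0 pi); congr pi; apply: val_inj.
by rewrite val_gr ?scale0r //; apply: mpow0.
Qed.

Lemma gr1 : gr 0 1 = 1.
Proof.
rewrite /gr -(rmorph1 pi); congr pi; apply: val_inj.
by rewrite val_gr ?scale1r // expr0.
Qed.

Lemma grM i j x y : M i x -> M j y -> gr i x * gr j y = gr (i + j) (x * y).
Proof.
move=> mx my; rewrite /gr -rmorphM; congr pi; apply: val_inj.
rewrite rmorphM /= !val_gr //; last exact: mpowM.
by rewrite -scalerAl -scalerAr scalerA exprD.
Qed.

Lemma gr_sum_eq0 N k (x : nat -> R) : (forall i, M (i + k) (x i)) ->
  \sum_(i < N) gr (i + k) (x i) = 0 -> forall i, (i < N)%N -> M (i + k).+1 (x i).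
Proof.
move=> mx; rewrite -rmorph_sum => /pi_gr_eq0 h i lt_i; move: (h (i + k)%N).
rewrite rmorph_sum /= coef_sum (bigD1 (Ordinal lt_i)) //= big1 ?addr0.
  by rewrite val_gr // coefZ coefXn eqxx mulr1.
move=> j; rewrite -val_eqE /= => nj; rewrite val_gr // coefZ coefXn.
by rewrite eqn_add2r eq_sym (negPf nj) mulr0.
Qed.

Lemma gr_eq0 n x : M n x -> gr n x = 0 <-> M n.+1 x.
Proof.
move=> mx; rewrite /gr pi_gr_eq0 val_gr //; split=> [/(_ n)|h i].
  by rewrite coefZ coefXn eqxx mulr1.
rewrite coefZ coefXn; case: eqP => [->|_]; first by rewrite mulr1.
by rewrite mulr0; apply: mpow0.
Qed.

Lemma irrelevant_gr N (x : nat -> R) : (forall i, M i (x i)) ->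
  irrelevant_ideal (@assoc_grade R) (\sum_(i < N.+1) gr i (x i)) <-> M 1 (x 0%N).
Proof.
move=> mx; split=> [[n [y [yg e]]]|m0].
  have /choice_exists[p hp] : forall i, exists p : rees R, (val p)`_0 = 0 /\ y i = pi p.
    by move=> i; have [p hp ->] := yg i; exists p; split=> //; apply: hp.
  have : pi (\sum_(i < N.+1) insubd (0 : rees R) (x i *: 'X^i) - \sum_(i < n) p i) = 0.
    rewrite rmorphB !rmorph_sum /=; apply/eqP; rewrite subr_eq0; apply/eqP.
    by rewrite -/(gr _ _) [LHS]e; apply: eq_bigr => i _; rewrite (hp i).2.
  move=> /pi_gr_eq0/(_ 0%N); rewrite rmorphB !rmorph_sum /= coefB !coef_sum.
  rewrite [X in _ - X]big1 ?subr0; last by move=> i _; apply: (hp i).1.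
  rewrite big_ord_recl /= big1 ?addr0; last first.
    by move=> i _; rewrite val_gr // coefZ coefXn mulr0.
  by rewrite val_gr // coefZ coefXn eqxx mulr1.
exists N, (fun i => gr i.+1 (x i.+1)); split=> [i|]; first exact: gr_grade.
by rewrite big_ord_recl /= (_ : gr 0 _ = 0) ?add0r //; apply/gr_eq0.
Qed.

Definition grmx n p q (A : 'M[R]_(p, q)) : 'M[G]_(p, q) := map_mx (gr n) A.

Lemma grmxM i j p q r (A : 'M[R]_(p, q)) (B : 'M[R]_(q, r)) :
  inM i A -> inM j B -> grmx i A *m grmx j B = grmx (i + j) (A *m B).
Proof.
move=> mA mB; apply/matrixP => k l; rewrite !mxE.
under eq_bigr do rewrite !mxE grM //.
have [_ <-] : M (i + j) (\sum_t A k t * B t l) /\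
    gr (i + j) (\sum_t A k t * B t l) = \sum_t gr (i + j) (A k t * B t l); last by [].
elim/big_ind2: _ => [|x x' y y' [mx ex] [my ey]|t _].
- by rewrite gr0; split=> //; apply: mpow0.
- by rewrite grD // ex ey; split=> //; apply: mpowD.
- by split=> //; apply: mpowM.
Qed.

Lemma grmx_eq0 n p q (A : 'M[R]_(p, q)) : inM n A -> grmx n A = 0 <-> inM n.+1 A.
Proof.
move=> mA; split=> [/matrixP h i j|h].
  by apply/gr_eq0; [apply: mA|move: (h i j); rewrite !mxE].
by apply/matrixP => i j; rewrite !mxE; apply/gr_eq0.
Qed.

Lemma grmxB_eq n p q (A B : 'M[R]_(p, q)) : inM n A -> inM n B -> inM n.+1 (A - B) ->
  grmx n A = grmx n B.
Proof.
move=> mA mB mAB; apply/matrixP => i j; rewrite !mxE.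
rewrite -[A i j](subrK (B i j)) grD //; last by apply: mpowB.
have h := mAB i j; rewrite !mxE in h.
by rewrite (_ : gr n (_ - _) = 0) ?add0r //; apply/gr_eq0 => //; apply: mpowB.
Qed.

Lemma grmx_sum_eq0 N k p q (A : nat -> 'M[R]_(p, q)) :
  (forall i, inM (i + k) (A i)) -> \sum_(i < N) grmx (i + k) (A i) = 0 ->
  forall i, (i < N)%N -> inM (i + k).+1 (A i).
Proof.
move=> mA /matrixP h i lt_i i' j.
apply: (@gr_sum_eq0 N k (fun i => A i i' j)) => // [l|]; first exact: mA.
by move: (h i' j); rewrite summxE mxE; under eq_bigr do rewrite mxE.
Qed.

Hypothesis M4 : M 4 = [set 0].

Lemma gr_decomp (z : G) : exists x : nat -> R,
  (forall i, M i (x i)) /\ z = \sum_(i < 4) gr i (x i).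
Proof.
rewrite -[z]reprK; set p := repr z; exists (fun i => (val p)`_i).
split=> [i|]; first exact: reesP.
rewrite -rmorph_sum; congr pi; apply: val_inj; apply/polyP => k.
rewrite rmorph_sum /= coef_sum.
have grE (i : 'I_4) : (val (insubd (0 : rees R) ((val p)`_i *: 'X^i)))`_k =
    (val p)`_i * (k == i)%:R by rewrite val_gr ?coefZ ?coefXn //; apply: reesP.
rewrite (eq_bigr _ (fun i _ => grE i)).
case: (ltnP k 4) => hk.
  rewrite (bigD1 (Ordinal hk)) //= eqxx mulr1 big1 ?addr0 // => i.
  by rewrite -val_eqE /= eq_sym => /negPf->; rewrite mulr0.
rewrite big1; first by apply: (mpow4_eq0 M4); apply: mpow_le hk (reesP p k).
by move=> i _; rewrite gtn_eqF ?mulr0 //; apply: leq_trans (ltn_ord i) hk.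
Qed.

Lemma grmx_decomp p q (V : 'M[G]_(p, q)) : exists A : nat -> 'M[R]_(p, q),
  (forall i, inM i (A i)) /\ V = \sum_(i < 4) grmx i (A i).
Proof.
have h (ij : 'I_p * 'I_q) := gr_decomp (V ij.1 ij.2).
have [f hf] := choice_exists h.
exists (fun n => \matrix_(i, j) f (i, j) n); split.
  by move=> n i j; rewrite mxE; apply: (hf (i, j)).1.
apply/matrixP => i j; rewrite summxE (hf (i, j)).2.
by apply: eq_bigr => n _; rewrite !mxE.
Qed.

Variables (b : nat -> nat) (D : forall i, 'M[R]_(b i.+1, b i)).
Hypothesis mD : forall i, inM 1 (D i).
Hypothesis minD : forall i (v : 'rV[R]_(b i.+1)), v *m D i = 0 -> inM 1 v.
Hypothesis socD : forall i (y : 'rV[R]_(b i)), inM 3 y -> imM 2 (D i) y.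
Hypothesis exD : forall i (v : 'rV[R]_(b i.+1)), v *m D i = 0 <-> exists w, v = w *m D i.+1.
Hypothesis linD : forall i (y : 'rV[R]_(b i.+1)), inM 2 y -> y *m D i = 0 -> imM 1 (D i.+1) y.
Variables (C : 'M[R]_(b 0, 1)) (C' : 'M[R]_(1, b 0)).
Hypotheses (CC' : C *m C' = 1%:M) (C'C : C' *m C = 1%:M).
Hypothesis gen0 : forall n (y : 'rV[R]_1), inM n.+1 y -> imM n (D 0%N *m C) y.

(** By linearity v D_i = w D_i with w in m, and v - w is then in m by minimality. *)
Lemma mpow2_image i (v : 'rV[R]_(b i.+1)) : inM 2 (v *m D i) -> inM 1 v.
Proof.
move=> h; suff [w mw hw] : imM 1 (D i) (v *m D i).
  rewrite -[v](subrK w); apply: inMD => //.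
  by apply: (@minD i); rewrite mulmxBl hw subrr.
case: i v h => [|i] v h; last first.
  by apply: linD => //; apply/exD; exists v.
have [|w mw hw] := @gen0 1 (v *m D 0%N *m C); first exact: inMMr.
exists w => //; rewrite -[LHS]mulmx1 -[RHS]mulmx1 -CC' !mulmxA hw.
by rewrite !mulmxA.
Qed.

(** A cycle is treated one degree at a time: its part of degree j lifts to A_j with A_j D_i in
    m^(j+2), and only A_j modulo m^(j+1) has to be matched. *)
Lemma graded_exact i (v : 'rV[G]_(b i.+1)) :
  v *m grmx 1 (D i) = 0 <-> exists w, v = w *m grmx 1 (D i.+1).
Proof.
have DD : D i.+1 *m D i = 0.
  by apply/row_matrixP => j; rewrite row_mul row0; apply/exD; exists (delta_mx 0 j); rewrite rowE.
split=> [|[w ->]]; last first.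
  rewrite -mulmxA grmxM // DD (_ : grmx _ 0 = 0) ?mulmx0 //.
  by apply/grmx_eq0; apply: inM0.
have [A [mA ->]] := grmx_decomp v; rewrite mulmx_suml => h.
have {}h j : (j < 4)%N -> inM (j + 1).+1 (A j *m D i).
  apply: (@grmx_sum_eq0 4 1 _ _ (fun j => A j *m D i)) => [k|]; first exact: inMM.
  by rewrite -[RHS]h; apply: eq_bigr => k _; rewrite grmxM.
have e0 : grmx 0 (A 0%N) = 0 by apply/grmx_eq0 => //; apply/mpow2_image/(h 0%N).
(* As A_1 D_i is in m^3, it equals w D_i with w in m^2; passing to A_1 - w keeps the initial form
   and gives a true cycle. *)
have [w1 e1] : exists w, grmx 1 (A 1%N) = w *m grmx 1 (D i.+1).
  have [//|w mw hw] := @socD i (A 1%N *m D i); first exact: (h 1%N).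
  have [u hu] : exists u, A 1%N - w = u *m D i.+1.
    by apply/exD; rewrite mulmxBl hw subrr.
  exists (grmx 0 u); rewrite grmxM // -hu.
  apply: grmxB_eq => //; last by rewrite subKr.
  by apply: inMB => // k l; apply: (@mpow_le _ 1 2).
have [w2 e2] : exists w, grmx 2 (A 2%N) = w *m grmx 1 (D i.+1).
  have [//||w mw hw] := @linD i (A 2%N).
    by apply/matrixP => k l; rewrite [RHS]mxE; apply: (mpow4_eq0 M4); apply: (h 2%N).
  by exists (grmx 1 w); rewrite grmxM // -hw.
have [w3 e3] : exists w, grmx 3 (A 3%N) = w *m grmx 1 (D i.+1).
  have [//|w mw hw] := @socD i.+1 (A 3%N).
  by exists (grmx 2 w); rewrite grmxM // -hw.
exists (w1 + w2 + w3).
by rewrite !big_ord_recr big_ord0 /= e0 e1 e2 e3 !mulmxDl !add0r.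
Qed.

Lemma graded_aug (v : 'rV[G]_(b 0)) :
  irrelevant_ideal (@assoc_grade R) ((v *m grmx 0 C) 0 0) <->
  exists w, v = w *m grmx 1 (D 0%N).
Proof.
split=> [|[w ->]].
  have [A [mA eA]] := grmx_decomp (v *m grmx 0 C).
  rewrite eA summxE; under eq_bigr do rewrite mxE.
  have irrA := @irrelevant_gr 3 (fun n => A n 0 0) (fun n => mA n 0 0).
  move=> /irrA m0.
  have e0 : grmx 0 (A 0%N) = 0 by apply/grmx_eq0 => // i j; rewrite !ord1.
  have ei n : exists w, grmx n.+1 (A n.+1) = w *m grmx 1 (D 0%N *m C).
    have [//|w mw ->] := @gen0 n (A n.+1).
    by exists (grmx n w); rewrite grmxM ?addn1 //; apply: inMMr.
  have [w1 e1] := ei 0%N; have [w2 e2] := ei 1%N; have [w3 e3] := ei 2%N.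
  exists (w1 + w2 + w3).
  have I1 n : grmx 0 (1%:M : 'M[R]_n) = 1%:M.
    by apply/matrixP => k l; rewrite !mxE; case: eqP => _; rewrite ?gr1 ?gr0.
  have CC : grmx 0 C *m grmx 0 C' = 1%:M by rewrite grmxM // CC' I1.
  rewrite -[v]mulmx1 -CC mulmxA eA !big_ord_recr big_ord0 /= e0 e1 e2 e3 !add0r.
  by rewrite -!mulmxDl -(grmxM (i := 1) (j := 0)) // -!mulmxA CC mulmx1.
have [A [mA ->]] := grmx_decomp w.
rewrite -mulmxA grmxM // mulmx_suml summxE.
exists 4%N, (fun n => gr n.+1 ((A n *m (D 0%N *m C)) 0 0)); split; first by move=> n; apply: gr_grade.
apply: eq_bigr => n _; rewrite grmxM // ?addn1; last exact: inMMr.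
by rewrite mxE.
Qed.

Lemma graded_koszul : koszul R.
Proof.
exists b, (fun i => grmx 1 (D i)), (grmx 0 C); split.
- split; [|exact: graded_aug|exact: graded_exact].
  exists (grmx 0 C'); rewrite grmxM // C'C mxE mxE eqxx gr1 subrr.
  by exists 0%N, (fun=> 0); split=> [i|]; [rewrite -(gr0 i.+1); apply: gr_grade|rewrite big_ord0].
- by move=> i; rewrite mxE; apply: gr_grade.
- by move=> i j l; rewrite mxE; apply: gr_grade.
Qed.

End Graded.

(** * The main theorem *)

Section Assembly.
Variable R : localRingType.
Local Notation M := (idpow (maxid R)).
Variables (a b s : R) (e : nat) (x y : 'I_e -> R).
Hypotheses (M4 : M 4 = [set 0]) (M3s : M 3 s) (s0 : s != 0).
Hypothesis E : exact_pair_axioms a b s (off_line a).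
Hypothesis socP : forall z, (forall r, M 1 r -> z * r = 0) -> exists t, z = t * s.
Hypothesis Mx : forall i, M 1 (x i).
Hypothesis xspan : forall z, M 1 z -> exists c : 'I_e -> R, M 2 (z - \sum_i c i * x i).
Hypothesis xfree : forall c : 'I_e -> R, M 2 (\sum_i c i * x i) -> forall i, M 1 (c i).
Hypothesis My : forall i, M 2 (y i).
Hypothesis xy : forall i j, x i * y j = (i == j)%:R * s.

Lemma kdim_mpow0 : has_kdim (M 0 : set R^o) (M 1) 1.
Proof.
exists (fun=> 1); split=> // [z _|c].
  by exists (fun=> z); rewrite big_ord1 [_ *: _]mulr1 subrr; apply: mpow0.
by rewrite big_ord1 [_ *: _]mulr1 mpow1 => h i; rewrite ord1.
Qed.

Lemma kdim_mpow1 : has_kdim (M 1 : set R^o) (M 2) e.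
Proof. by exists x; split=> // c hc i; rewrite -mpow1; apply: xfree. Qed.

(** Multiplication by x_i reads off the i-th coordinate on y. An element of m^2 with all coordinates
    removed is killed by m, hence lies in the socle, which is inside m^3. *)
Lemma kdim_mpow2 : has_kdim (M 2 : set R^o) (M 3) e.
Proof.
have xsum (c : 'I_e -> R) i : x i * (\sum_j c j *: (y j : R^o)) = c i * s.
  rewrite mulr_sumr (bigD1 i) //= big1 ?addr0.
    by rewrite [_ *: _]/(_ * _) mulrCA xy eqxx mul1r.
  by move=> j; rewrite [_ *: _]/(_ * _) mulrCA xy eq_sym => /negPf->; rewrite mul0r mulr0.
exists y; split=> // [z mz|c hc i].
  have [i|c hc] := @choice_exists _ _ (fun i c => x i * z = c * s).
    by apply/(ep_soc E)/(mpowM (Mx i) mz).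
  exists c; set z' := z - _.
  have xz' i : x i * z' = 0 by rewrite mulrBr xsum hc subrr.
  have mz' : M 2 z' by apply: mpowB => //; apply: mpow_sum => j _; apply: mpowMl.
  have z'0 r : M 1 r -> r * z' = 0.
    move=> /xspan[d hd]; rewrite -[r](subrK (\sum_i d i * x i)) mulrDl.
    rewrite (mpow4_eq0 M4 (mpowM hd mz')) add0r mulr_suml big1 // => j _.
    by rewrite -mulrA xz' mulr0.
  have [|t ->] := socP (z := z'); first by move=> r /z'0; rewrite mulrC.
  exact: mpowMl.
rewrite -mpow1; apply: (socle_ann s0); rewrite -xsum.
by apply/(mpow4_eq0 M4)/(mpowM (Mx i) hc).
Qed.

Lemma kdim_mpow3 : has_kdim (M 3 : set R^o) (M 4) 1.
Proof.
exists (fun=> s); split=> // [z /(ep_soc E)[t ->]|c].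
  by exists (fun=> t); rewrite big_ord1 subrr; apply: mpow0.
rewrite big_ord1 => h i; rewrite ord1 -mpow1.
exact/(socle_ann s0)/(mpow4_eq0 M4).
Qed.

Lemma gorenstein3_compressed : edim R = e -> compressed R.
Proof.
move=> ee; exists 3%N.
  by split=> // h; move: M3s s0; rewrite h => -> /eqP.
(* The truncated [edim - 1] calls for e > 0; if e were 0, then m = m^2 and s would vanish. *)
have [k ek] : exists k, e = k.+1.
  case: (posnP e) => [e0|e_gt0]; last by exists e.-1; rewrite prednK.
  have := kdim_mpow1; rewrite e0 => -[v [_ vspan _]].
  have M10 z : M 1 z -> M 2 z by move=> /vspan[c]; rewrite big_ord0 subr0.
  have step n z : M n.+1 z -> M n.+2 z.
    case=> l [f [g [fg ->]]]; apply: mpow_sum => i' _.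
    by apply: (@mpowM _ 2 n); [apply/M10/mpow1E|]; case: (fg i').
  have : s = 0 by apply: (mpow4_eq0 M4); apply: step.
  by move=> s00; move: s0; rewrite s00 eqxx.
rewrite ee ek => i.
have bin_le n : (0 < n)%N -> (k.+1 <= 'C(k + n, k))%N.
  by move=> n0; rewrite -{1}(binSn k); apply: leq_bin2l; lia.
rewrite subn1 /=; case: i => [|[|[|[|//]]]] _.
- rewrite addn0 binn (_ : minn _ _ = 1%N); first exact: kdim_mpow0.
  by apply/minn_idPl; rewrite bin_gt0; lia.
- rewrite addn1 binSn (_ : minn _ _ = k.+1); first by rewrite -ek; apply: kdim_mpow1.
  by apply/minn_idPl; apply: bin_le; lia.
- rewrite addn1 binSn (_ : minn _ _ = k.+1); first by rewrite -ek; apply: kdim_mpow2.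
  by apply/minn_idPr; apply: bin_le; lia.
- rewrite subnn addn0 binn (_ : minn _ _ = 1%N); first exact: kdim_mpow3.
  by apply/minn_idPr; rewrite bin_gt0; lia.
Qed.

Local Notation x_col := (\col_i x i).

Lemma col_in : inM 1 x_col.
Proof. by move=> i j; rewrite mxE. Qed.

Lemma col_min (u : 'rV[R]_e) : u *m x_col = 0 -> inM 1 u.
Proof.
move=> /matrixP/(_ 0 0); rewrite !mxE => h i j; rewrite ord1.
apply: (xfree (c := fun i => u 0 i)).
by move: h; under eq_bigr do rewrite mxE; move=> ->; apply: mpow0.
Qed.

(** Successive approximation again, now keeping the coefficients in m^n. *)
Lemma col_gen n (z : 'rV[R]_1) : inM n.+1 z -> imM n x_col z.
Proof.
have step k t : M k.+1 t -> exists w : 'rV[R]_e, inM k w /\ M k.+2 (t - (w *m x_col) 0 0).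
  case=> l [f [g [fg ->]]].
  have [i|c hc] := @choice_exists _ _ (fun i (c : 'I_e -> R) => M 2 (f i - \sum_j c j * x j)).
    by apply: xspan; rewrite mpow1; case: (fg i).
  exists (\row_j \sum_i g i * c i j); split.
    by move=> i j; rewrite mxE; apply: mpow_sum => i' _; apply: mpowMr; case: (fg i').
  have -> : ((\row_j \sum_i g i * c i j) *m x_col) 0 0 = \sum_i (\sum_j c i j * x j) * g i.
    rewrite mxE; under eq_bigr do rewrite !mxE mulr_suml.
    rewrite exchange_big; apply: eq_bigr => i _; rewrite mulr_suml.
    by apply: eq_bigr => j _; rewrite mulrAC mulrC mulrA mulrAC.
  rewrite -sumrB; apply: mpow_sum => i _; rewrite -mulrBl.
  by apply: (mpowM (hc i)); case: (fg i).
have all j t : M n.+1 t -> exists w : 'rV[R]_e, inM n w /\ M (n + j).+1 (t - (w *m x_col) 0 0).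
  move=> mt; elim: j => [|j [w [mw /step[w' [mw' h]]]]].
    by exists 0; split; [exact: inM0|rewrite mul0mx mxE subr0 addn0].
  exists (w + w'); split; first by apply: inMD => // i k; apply: mpow_le (leq_addr j n) (mw' i k).
  by rewrite mulmxDl mxE opprD addrA addnS.
move=> /(_ 0 0)/(all 4)[w [mw h]]; exists w => //.
apply/matrixP => i j; rewrite !ord1; apply/eqP; rewrite -subr_eq0; apply/eqP.
by apply: (mpow4_eq0 M4); apply: mpow_le h; lia.
Qed.

Lemma linear_resolution : exists (bR : nat -> nat) (D : forall i, 'M[R]_(bR i.+1, bR i))
    (C : 'M[R]_(bR 0, 1)) (C' : 'M[R]_(1, bR 0)),
  [/\ [/\ bR 0 = 1, bR 1 = e, C *m C' = 1%:M & C' *m C = 1%:M]%N,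
      forall n (z : 'rV[R]_1), inM n.+1 z -> imM n (D 0%N *m C) z,
      forall i, linear_syzygy a b (off_line a) (D i)
    & forall i, syzygy_of (D i.+1) (D i)].
Proof.
pose P0 r p (S : 'M[R]_(r, p)) := exists (C : 'M[R]_(p, 1)) (C' : 'M[R]_(1, p)),
  [/\ p = 1, r = e, C *m C' = 1%:M & C' *m C = 1%:M]%N /\
  forall n (z : 'rV[R]_1), inM n.+1 z -> imM n (S *m C) z.
have [||| bR [D [[C [C' [h gen]]] hP hQ]]] := @matrix_chain R P0
  (fun _ r p => @linear_syzygy R a b (off_line a) r p) (fun r' r p => @syzygy_of R r' r p)
  _ _ x_col.
- by move=> _ r p S; apply: linear_syzygy_step E _ _ _.
- exists 1%:M, 1%:M; rewrite !mulmx1; split=> //; exact: col_gen.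
- by apply: (linear_syzygy_start E); [exact: col_in|exact: col_min|exact: col_gen].
- by exists bR, D, C, C'; split.
Qed.

Lemma koszul_not_golod : koszul R /\ ~ golod {ideal_quot (mpow R 3)}.
Proof.
have [bR [D [C [C' [[b0 b1 CC' C'C] gen LS SY]]]]] := linear_resolution.
have mD i : inM 1 (D i) := ls_in (LS i).
have minD i (v : 'rV_(bR i.+1)) : v *m D i = 0 -> inM 1 v := ls_min (LS i) (u := v).
have exD i (v : 'rV_(bR i.+1)) : v *m D i = 0 <-> exists w, v = w *m D i.+1 := (SY i).1 v.
have socD i (z : 'rV_(bR i)) : inM 3 z -> imM 2 (D i) z.
  by move=> mz; apply: (ls_soc (LS i)).
have linD i (z : 'rV_(bR i.+1)) : inM 2 z -> z *m D i = 0 -> imM 1 (D i.+1) z.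
  by move=> mz Dz; apply: (SY i).2.
split; first exact: (graded_koszul M4 mD minD socD exD linD CC' C'C gen).
have [W hW] : exists W : forall i, 'M[R]_(bR i, bR i.+1),
    forall i, inM 2 (W i) /\ W i *m D i = s%:M.
  have h i : {W : 'M[R]_(bR i, bR i.+1) | inM 2 W /\ W *m D i = s%:M}.
    by apply: cid; have [W mW WD] := socle_lift (LS i) M3s; exists W.
  by exists (fun i => sval (h i)) => i; exact: (svalP (h i)).
have [d hd] := choice_exists (fun i => kdim_image (D i) kdim_mpow1).
have bd i : (bR i.+1 * e = bR i.+2 + d i)%N.
  exact: (kdim_first kdim_mpow1 (LS i.+1) (SY i) (hd i)).
have bd' i : (bR i.+1 * e = d i.+1 + bR i)%N.
  exact: (kdim_second M4 kdim_mpow2 E (LS i) (LS i.+1) (SY i) (hd i.+1) s0 M3s).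
have imD n : imM n (D 0%N) = inM n.+1.
  apply/seteqP; split=> v; first by case=> w mw ->; rewrite -addn1; apply: inMM.
  move=> mv; have [|w mw hw] := gen n (v *m C); first exact: inMMr.
  exists w => //; rewrite -[LHS]mulmx1 -[RHS]mulmx1 -CC' !mulmxA hw.
  by rewrite !mulmxA.
(* By [imD], this is the dimension of m^2/m^3. *)
have d0 : d 0%N = e.
  have := hd 0%N; rewrite !imD => h.
  rewrite -[RHS]mul1n -[X in (X * e)%N]b0.
  apply: kdim_unique h (kdim_rows (bR 0) kdim_mpow2).
  - exact: inM_submod.
  - exact: inM_submod.
  - by move=> c z mc mz; apply: (inMZ mc mz).
have [bQ [DQ [cQ [resQ minQ bQE]]]] :=
  quotient_resolution M4 M3s s0 (ep_soc E) mD exD (fun i => (hW i).1)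
    (fun i => (hW i).2) CC' (fun z mz => let: ex_intro2 w _ h := gen 0%N z mz in ex_intro _ w h).
case=> dep [sq [h [P [_ _ _ [bP [DP [cP [resP hP]]]] hq]]]].
have PS i : P i.+1 = (quotient_betti bR i).2.
  rewrite -bQE; apply: (tor_betti_unique resP resQ (hP i.+1)).
  exact: tor_betti_minimal.
set q := (1 - _ : {poly int}) in hq.
have q0 : q`_0 = 1.
  rewrite /q coefB coef1 coef_sum big1 ?subr0 // => j _.
  by rewrite coefZ coefXn mulr0.
have q3 : q`_(edim {ideal_quot (mpow R 3)} + 3) = 0.
  rewrite /q coefB coef1 coef_sum big_nat big1 ?subr0; first by rewrite addnS.
  move=> j /andP[_ hj]; rewrite coefZ coefXn; case: eqP => [ej|_]; last by rewrite mulr0.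
  by exfalso; lia.
(* Tor was compared in positive degrees only; degree 0 is read off the Golod identity itself. *)
have P0 : P 0%N = 1%N.
  have := hq 0%N; rewrite big_ord1 subnn q0 mulr1 => /eqP.
  rewrite -horner_coef0 horner_exp !hornerE expr1n; by move=> /eqP [].
exact: (betti_not_golod b0 b1 d0 bd bd' P0 PS q3 hq).
Qed.

End Assembly.

Theorem mainTheorem4 (R : localRingType)
    (artR : artinian R) (gorR : gorenstein R)
    (edimR : (3 <= edim R)%N) (socR : socle_degree R 3)
    (ezdR : exists a : R, exact_zero_divisor a) :
  [/\ compressed R, koszul R & ~ golod {ideal_quot (mpow R 3)}].
Proof.
have [M4 M3] := socR.
have [s [M3s s0]] : exists s, idpow (maxid R) 3 s /\ s != 0.
  apply: contrapT => h; apply: M3; apply/seteqP; split=> z; last by move=> ->; apply: mpow0.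
  by move=> mz; apply: contrapT => /eqP z0; apply: h; exists z.
have SI : baer (setT : set (R^o : lmodType R)).
  by apply: (gorenstein_baer M4 s0) => // r; apply: (socle_mul M4 M3s).
have [a [a0 [c c0 ac] [b annb]]] := ezdR.
have annE y : a * y = 0 <-> exists u, y = b * u.
  have -> : (a * y = 0) = gen [:: b] y by rewrite -annb.
  split=> [[f ->]|[u ->]]; first by exists (f 0%N); rewrite big_ord1 mulrC.
  by exists (fun=> u); rewrite big_ord1 mulrC.
have ab : a * b = 0 by apply/annE; exists 1; rewrite mulr1.
have ma : idpow (maxid R) 1 a.
  case: (mpow_dichotomy a) => // -[a' aa'].
  by move: c0; rewrite -[c]mul1r -aa' mulrAC ac mul0r eqxx.
have mb : idpow (maxid R) 1 b.
  case: (mpow_dichotomy b) => // -[b' bb'].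
  by move: a0; rewrite -[a]mulr1 -bb' mulrA ab mul0r eqxx.
have annab y : a * y = 0 -> exists u, y = b * u by move/annE.
(* Self-injectivity makes the pair symmetric: if b y = 0, then y is killed by 0 : a = (b), hence is
   a multiple of a. *)
have annba y : b * y = 0 -> exists u, y = a * u.
  move=> hy; have [|u ->] := @baer_principal R SI a y.
    by move=> r /annab[u ->]; rewrite mulrA [y * b]mulrC hy mul0r.
  by exists u; rewrite mulrC.
have [w [mw aw]] := exact_mpow2_nonzero SI M4 M3s s0 edimR ma mb annab.
have [v [mv bv]] := exact_mpow2_nonzero SI M4 M3s s0 edimR mb ma annba.
have E : exact_pair_axioms a b s (off_line a).
  split=> //.
  - by move=> u; rewrite mulrC; apply: (exact_notin_mpow2 SI M4 M3s s0 edimR ma mb annab).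
  - by move=> u; rewrite mulrC; apply: (exact_notin_mpow2 SI M4 M3s s0 edimR mb ma annba).
  - by move=> z; apply: (mpow3_socle SI M4 s0).
  - by exists w.
  - by exists v.
  - exact: (off_line_exists M4 edimR ma).
  - by move=> l [].
  - by move=> l y; apply: (off_line_mpow2 SI M4 M3s s0 edimR ma mb annab annba).
  - by move=> l; apply: (off_line_mpow2_sum SI M4 M3s s0 edimR ma mb annab annba).
have [x [Mx xspan xind]] := edim_kdim M4.
have xfree (f : 'I_(edim R) -> R) : idpow (maxid R) 2 (\sum_i f i * x i) ->
    forall i, idpow (maxid R) 1 (f i) by move=> hf i; rewrite mpow1; apply: xind.
have [y [My xy]] := dual_basis SI M4 M3s (ann_mpow2 SI M4 M3s s0 edimR ma mb annab annba)
  Mx xspan xfree.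
have socP z : (forall r, idpow (maxid R) 1 r -> z * r = 0) -> exists t, z = t * s.
  exact: (socle_gen SI s0).
have [kos ngol] := koszul_not_golod M4 M3s s0 E socP Mx xspan xfree My xy.
split=> //; exact: (gorenstein3_compressed M4 M3s s0 E socP Mx xspan xfree My xy).
Qed.
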